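(* Let $d=3$ and $\delta>0$. Then the nonlocal FEM stiffness matrix $\boldsymbol S_\delta$ has the following three-level Toeplitz structure. It is the $N_3$-by-$N_3$ block matrix whose $(p,q)$ block is $\boldsymbol T_{x_1,x_2,|p-q|}$, $1\le p,q\le N_3$. For each $0\le k_3\le N_3-1$, $\boldsymbol T_{x_1,x_2,k_3}$ is the $N_2$-by-$N_2$ block matrix whose $(p,q)$ block is $\boldsymbol T_{x_1,|p-q|,k_3}$, $1\le p,q\le N_2$. For each $0\le k_2\le N_2-1$, $0\le k_3\le N_3-1$, $\boldsymbol T_{x_1,k_2,k_3}$ is the $N_1$-by-$N_1$ symmetric Toeplitz matrix whose $(p,q)$ entry is $t_{|p-q|,k_2,k_3}$, $1\le p,q\le N_1$. The entries $t_{k_1,k_2,k_3}$ are given by $$t_{k_1,k_2,k_3}=\frac{h^3}{2}\int_0^\delta\int_0^\pi\int_0^{2\pi}\hat f_{k_1,k_2,k_3}(r,\theta,\varphi)\sin(\theta)\,\mathrm{d}\varphi\,\mathrm{d}\theta\;\rho_\delta(r)r^2\,\mathrm{d}r,$$ where $$\begin{aligned}\hat f_{k_1,k_2,k_3}&(r,\theta,\varphi)=2B_3(k_1+2)B_3(k_2+2)B_3(k_3+2)\\&-B_3(k_1+2-r\sin\theta\cos\varphi/h)\,B_3(k_2+2-r\sin\theta\sin\varphi/h)\,B_3(k_3+2-r\cos\theta/h)\\&-B_3(k_1+2+r\sin\theta\cos\varphi/h)\,B_3(k_2+2+r\sin\theta\sin\varphi/h)\,B_3(k_3+2+r\cos\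theta/h).\end{aligned}$$
   Context: Domain and grid: $\Omega=\prod_{j=1}^3(a_j,b_j)$ and $\widetilde\Omega=\prod_{j=1}^3(a_j-\delta,b_j+\delta)$. For $j=1,2,3$, $N_j\ge1$ is an integer and $h=(b_j-a_j)/(N_j+1)$ is the same for all $j$. Grid points are $\xi_{j,n_j}=a_j+n_jh$, $0\le n_j\le N_j+1$. Basis: for $1\le n_j\le N_j$, $\phi_{n_j}(x_j)$ is the hat function equal to $(x_j-\xi_{j,n_j-1})/h$ on $(\xi_{j,n_j-1},\xi_{j,n_j})$, equal to $(\xi_{j,n_j+1}-x_j)/h$ on $(\xi_{j,n_j},\xi_{j,n_j+1})$ (value $1$ at $\xi_{j,n_j}$), and zero elsewhere (extended by zero to all of $\mathbb{R}$). The 3D basis functions are $\phi_{n_1}(x_1)\phi_{n_2}(x_2)\phi_{n_3}(x_3)$. Kernel: $\mathbb{B}^3_\delta$ is the ball of radius $\delta$ centered at $0$; $\rho_\delta(|\boldsymbol s|)$ is a radial kernel, non-increasing in $|\boldsymbol s|$, with $\int_{\mathbb{B}^3_\delta}\rho_\delta(|\boldsymbol s|)|\boldsymbol s|^2\,\mathrm{d}\boldsymbol s=3$. Bilinear form: $$\mathcal{A}_\delta(u,v)=\frac12\int_{\widetilde\Omega}\int_{\mathbb{B}^3_\delta}(u(\boldsymbol x+\boldsymbol s)-u(\boldsymbol x))(v(\boldsymbol x+\boldsymbol s)-v(\boldsymbol x))\rho_\delta(|\boldsymbol s|)\,\mathrm{d}\boldsymbol s\,\mathrm{d}\boldsymbol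 x.$$ The stiffness matrix $\boldsymbol S_\delta\in\mathbb{R}^{N_1N_2N_3\times N_1N_2N_3}$ has entries $(\boldsymbol S_\delta)_{ll'}=\mathcal{A}_\delta(\phi_{n_1}\phi_{n_2}\phi_{n_3},\phi_{m_1}\phi_{m_2}\phi_{m_3})$ with $l=(n_3-1)N_1N_2+(n_2-1)N_1+n_1$, $l'=(m_3-1)N_1N_2+(m_2-1)N_1+m_1$. Cubic B-spline: $B_3(t)=t^3/6$ on $[0,1)$; $-t^3/2+2t^2-2t+2/3$ on $[1,2)$; $t^3/2-4t^2+10t-22/3$ on $[2,3)$; $-(t-4)^3/6$ on $[3,4)$; $0$ elsewhere. *)

(* Defs.v *)
From HB Require Import structures.
From mathcomp Require Import all_boot all_order all_algebra.
From mathcomp Require Import all_classical all_reals all_analysis.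
Set Implicit Arguments.
Unset Strict Implicit.
Unset Printing Implicit Defensive.
Import Order.TTheory GRing.Theory Num.Theory.
Import numFieldNormedType.Exports.
Local Open Scope classical_set_scope.
Local Open Scope ring_scope.

Section Space.
Variable R : realType.

(* Points of R^3 are triples ((x1, x2), x3). *)
Definition space3 : Type := (R * R * R)%type.

Definition lebesgue3 :
  {measure set (measurableTypeR R * measurableTypeR R * measurableTypeR R)
     -> \bar R} :=
  ((@lebesgue_measure R \x @lebesgue_measure R) \x @lebesgue_measure R)%E.

Definition norm3 (s : space3) : R :=
  Num.sqrt (s.1.1 ^+ 2 + s.1.2 ^+ 2 + s.2 ^+ 2).

Definition ball3 (delta : R) : set space3 := [set s | norm3 s < delta].

Definition box3 (a b : space3) : set space3 :=
  [set x | [/\ a.1.1 < x.1.1 < b.1.1, a.1.2 < x.1.2 < b.1.2 & a.2 < x.2 < b.2]].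

Definition enlarged_box3 (a b : space3) (delta : R) : set space3 :=
  box3 (a - (delta, delta, delta)) (b + (delta, delta, delta)).

Definition bilinear_form (a b : space3) (delta : R) (rho : R -> R)
    (u v : space3 -> R) : R :=
  2^-1 *
  \int[lebesgue3]_(x in enlarged_box3 a b delta)
    \int[lebesgue3]_(s in ball3 delta)
      ((u (x + s) - u x) * (v (x + s) - v x) * rho (norm3 s)).

Definition grid (a h : R) (n : nat) : R := a + n%:R * h.

(* Meant for n >= 1, so that n.-1 is the true predecessor. *)
Definition hat (a h : R) (n : nat) (x : R) : R :=
  if grid a h n.-1 < x <= grid a h n then (x - grid a h n.-1) / h
  else if grid a h n <= x < grid a h n.+1 then (grid a h n.+1 - x) / h
  else 0.

Definition hat3 (a : space3) (h : R) (n1 n2 n3 : nat) (x : space3) : R :=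
  hat a.1.1 h n1 x.1.1 * hat a.1.2 h n2 x.1.2 * hat a.2 h n3 x.2.

(* The 0-based index l stands for i3 * (N2 * N1) + i2 * N1 + i1, i.e. for the
   basis function of 1-based multi-index (i1.+1, i2.+1, i3.+1); see
   stiffness_matrixE. *)
Definition basis (a : space3) (h : R) (N1 N2 : nat) (l : nat) : space3 -> R :=
  hat3 a h (l %% N1).+1 ((l %/ N1) %% N2).+1 (l %/ (N2 * N1)).+1.

Definition stiffness_matrix (a b : space3) (h delta : R) (rho : R -> R)
    (N1 N2 N3 : nat) : 'M[R]_(N3 * (N2 * N1)) :=
  \matrix_(l, l') bilinear_form a b delta rho
    (basis a h N1 N2 l) (basis a h N1 N2 l').

Lemma basisE (a : space3) (h : R) (N1 N2 n1 n2 n3 l : nat) :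
  (0 < n1 <= N1)%N -> (0 < n2 <= N2)%N -> (0 < n3)%N ->
  l.+1 = (n3.-1 * N1 * N2 + n2.-1 * N1 + n1)%N ->
  basis a h N1 N2 l = hat3 a h n1 n2 n3.
Proof.
case: n1 n2 n3 => [|i1] [|i2] [|i3] //= lt1 lt2 _; rewrite addnS => -[->].
have N1_gt0 : (0 < N1)%N by apply: leq_ltn_trans lt1.
have N2_gt0 : (0 < N2)%N by apply: leq_ltn_trans lt2.
have -> : (i3 * N1 * N2 + i2 * N1 + i1 = (i3 * N2 + i2) * N1 + i1)%N.
  by rewrite mulnDl mulnAC.
rewrite /basis modnMDl modn_small// divnMDl// divn_small// addn0.
rewrite modnMDl modn_small// [(N2 * N1)%N]mulnC divnMA divnMDl// (divn_small lt1) addn0.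
by rewrite divnMDl// divn_small// addn0.
Qed.

Lemma stiffness_matrixE (a b : space3) (h delta : R) (rho : R -> R)
    (N1 N2 N3 n1 n2 n3 m1 m2 m3 : nat) (l l' : 'I_(N3 * (N2 * N1))) :
  (0 < n1 <= N1)%N -> (0 < n2 <= N2)%N -> (0 < n3 <= N3)%N ->
  (0 < m1 <= N1)%N -> (0 < m2 <= N2)%N -> (0 < m3 <= N3)%N ->
  l.+1 = (n3.-1 * N1 * N2 + n2.-1 * N1 + n1)%N ->
  l'.+1 = (m3.-1 * N1 * N2 + m2.-1 * N1 + m1)%N ->
  stiffness_matrix a b h delta rho N1 N2 N3 l l' =
  bilinear_form a b delta rho (hat3 a h n1 n2 n3) (hat3 a h m1 m2 m3).
Proof.
move=> hn1 hn2 /andP[hn3 _] hm1 hm2 /andP[hm3 _] lE l'E; rewrite mxE.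
by rewrite (basisE a h hn1 hn2 hn3 lE) (basisE a h hm1 hm2 hm3 l'E).
Qed.

Definition toeplitz_mx (m : nat) (t : nat -> R) : 'M[R]_m :=
  \matrix_(p < m, q < m) t `|p - q|%N.

Lemma block_dim (m n : nat) : (\sum_(p < m) n = m * n)%N.
Proof. by rewrite sum_nat_const card_ord. Qed.

Definition block_toeplitz_mx (m n : nat) (T : nat -> 'M[R]_n) :
    'M[R]_(m * n) :=
  castmx (block_dim m n, block_dim m n)
    (\mxblock_(p < m, q < m) T `|p - q|%N).

Definition B3 (t : R) : R :=
  if 0 <= t < 1 then t ^+ 3 / 6
  else if 1 <= t < 2 then - (t ^+ 3) / 2 + 2 * t ^+ 2 - 2 * t + 2 / 3
  else if 2 <= t < 3 then t ^+ 3 / 2 - 4 * t ^+ 2 + 10 * t - 22 / 3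
  else if 3 <= t < 4 then - (t - 4) ^+ 3 / 6
  else 0.

Definition fhat (h : R) (k1 k2 k3 : nat) (r theta phi : R) : R :=
  2 * B3 (k1%:R + 2) * B3 (k2%:R + 2) * B3 (k3%:R + 2)
  - B3 (k1%:R + 2 - r * sin theta * cos phi / h)
    * B3 (k2%:R + 2 - r * sin theta * sin phi / h)
    * B3 (k3%:R + 2 - r * cos theta / h)
  - B3 (k1%:R + 2 + r * sin theta * cos phi / h)
    * B3 (k2%:R + 2 + r * sin theta * sin phi / h)
    * B3 (k3%:R + 2 + r * cos theta / h).

Definition toeplitz_entry (h delta : R) (rho : R -> R) (k1 k2 k3 : nat) : R :=
  h ^+ 3 / 2 *
  \int[lebesgue_measure]_(r in `[0, delta])
    ((\int[lebesgue_measure]_(theta in `[0, pi])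
        \int[lebesgue_measure]_(phi in `[0, (2 * pi)%R])
          (fhat h k1 k2 k3 r theta phi * sin theta))
     * rho r * r ^+ 2).

End Space.

(* Main.v *)
Require Import Defs.
From HB Require Import structures.
From mathcomp Require Import all_boot all_order all_algebra.
From mathcomp Require Import all_classical all_reals all_analysis.
From mathcomp Require Import measurable_realfun.
From mathcomp Require Import ring lra.
Set Implicit Arguments.
Unset Strict Implicit.
Unset Printing Implicit Defensive.
Import Order.TTheory GRing.Theory Num.Theory.
Import numFieldNormedType.Exports.
Local Open Scope classical_set_scope.
Local Open Scope ring_scope.

(** Expand the product of increments (u(x+s) - u(x)) (v(x+s) - v(x)) of two basis
    functions.  After integration over x, each of the four products is a product
    of three one-dimensional overlaps of hat functions, and the overlap of two
    hats is a tent function convolved with itself, that is h times a value of the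
    cubic B-spline [B3] (integral_tent_tent, hat3_overlap).  So the inner integral
    over x equals h^3 K(s), where K, called [increment_kernel], is the function
    whose spherical form is [fhat], with the signed offsets n_j - m_j in place of
    |n_j - m_j|.  As the rest of the integrand depends on |s| only, and as [B3] is
    symmetric about 2, reflecting the coordinates of s replaces the offsets by
    their absolute values.  Hence the entry depends on these only, which is the
    Toeplitz structure, and spherical coordinates yield the stated integral.

    Exchanging the two integrals needs absolute integrability although the
    kernel may be singular at 0 and of any sign.  The hats are Lipschitz, so the
    product of increments is at most L^2 |s|^2 and vanishes unless x is in the
    enlarged box; and rho(|s|) |s|^2 is integrable because its integral is 3,
    while the real-valued integral of a non-integrable measurable function is 0
    (integrable_cutoff, bilinear_form_swap).

    Spherical coordinates are obtained from one-dimensional substitutions that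
    hold for every nonnegative measurable function, since the kernel is
    merely monotone in |s|.  In the right half-plane, y = x tan(phi) for fixed x,
    then x = r cos(phi) for fixed phi, turn Tonelli's theorem into polar
    coordinates (ge0_integral_right_half_plane); two such half-planes give the
    plane.  Polar coordinates in the (x, y)-plane followed by polar coordinates
    in the half-plane of the points (sqrt(x^2 + y^2), z) are spherical coordinates
    (ge0_integral_spherical). *)

(** * Substitutions on the line for nonnegative measurable functions *)

Section line_substitutions.
Context {R : realType}.
Local Notation mu := (@lebesgue_measure R).
Local Open Scope ereal_scope.

Lemma ge0_integral_mrestr d (T : measurableType d) (m : {measure set T -> \bar R})
    (E : set T) (mE : measurable E) (f : T -> \bar R) :
  measurable_fun setT f -> (forall x, 0 <= f x) ->
  \int[mrestr m mE]_x f x = \int[m]_(x in E) f x.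
Proof.
move=> mf f0; rewrite -(setUv E) ge0_integral_setU//=.
- rewrite [X in _ + X](_ : _ = 0) ?adde0; last first.
    rewrite -(integral_measure_zero (~` E) f).
    apply: eq_measure_integral => A mA AE /=.
    by rewrite /mrestr (_ : A `&` E = set0) ?measure0//; exact/disjoints_subset.
  apply: eq_measure_integral => A mA AE /=.
  by rewrite /mrestr setIidl.
- exact: measurableC.
- by rewrite setUv.
- by rewrite disj_set2E setICr.
Qed.

Lemma ge0_integral_shift (f : R -> \bar R) (c : R) :
  measurable_fun setT f -> (forall x, 0 <= f x) ->
  \int[mu]_x f (x + c)%R = \int[mu]_x f x.
Proof.
move=> mf f0.
have mc : measurable_fun setT (fun x : R => x + c : measurableTypeR R)%R.
  exact: measurable_funD.
transitivity (\int[pushforward mu (fun x : R => x + c : measurableTypeR R)%R]_x f x).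
  by rewrite ge0_integral_pushforward//= => x _.
apply: eq_measure_integral => A mA _; apply/esym.
apply: lebesgue_measure_unique => // _ [[a b]] _ <- /=.
rewrite /pushforward (_ : _ @^-1` _ = [set` `](a - c), (b - c)]]%R)%classic; last first.
  by apply/seteqP; split => x /=; rewrite !in_itv/= ltrBlDr lerBrDr.
rewrite !lebesgue_measure_itv/= !lte_fin ltrD2r.
by case: ifP => // _; rewrite -!EFinB; congr EFin; ring.
Qed.

Lemma ge0_integral_opp (f : R -> \bar R) :
  measurable_fun setT f -> (forall x, 0 <= f x) ->
  \int[mu]_x f (- x)%R = \int[mu]_x f x.
Proof.
move=> mf f0.
transitivity (\int[pushforward mu (-%R : _ -> measurableTypeR R)]_x f x).
  by rewrite ge0_integral_pushforward//= => x _.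
by apply: eq_measure_integral => A mA _; exact: lebesgue_measureN.
Qed.

Lemma ge0_integral_scale (f : R -> \bar R) (c : R) : (0 < c)%R ->
  measurable_fun setT f -> (forall x, 0 <= f x) ->
  c%:E * \int[mu]_x f (c * x)%R = \int[mu]_x f x.
Proof.
move=> c0 mf f0.
have mc : measurable_fun setT (fun x : R => c * x : measurableTypeR R)%R.
  exact: measurable_funM.
have c0' : (0 <= c)%R by exact: ltW.
pose m : {measure set (measurableTypeR R) -> \bar R} :=
  measure_function_pushforward__canonical__measure_function_Measure mu mc.
transitivity (\int[mscale (NngNum c0') m]_x f x).
  by rewrite ge0_integral_mscale//= ge0_integral_pushforward//= => x _.
apply: eq_measure_integral => A mA _; apply/esym.
apply: lebesgue_measure_unique => // _ [[a b]] _ <- /=.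
rewrite /mscale/= /pushforward (_ : _ @^-1` _ = [set` `](a / c), (b / c)]]%R)%classic; last first.
  by apply/seteqP; split => x /=; rewrite !in_itv/= ltr_pdivrMr// ler_pdivlMr// mulrC.
rewrite !lebesgue_measure_itv/= !lte_fin ltr_pM2r ?invr_gt0//.
case: ifP => // _; last by rewrite mule0.
by rewrite -!EFinB -EFinM; congr EFin; field; rewrite gt_eqF.
Qed.

End line_substitutions.

Section tangent_substitution.
Context {R : realType}.
Local Notation mu := (@lebesgue_measure R).
Local Notation Ihalf := ([set` `](- (pi / 2)), (pi / 2)[%R] : set R).
Local Open Scope ereal_scope.

(** The measure with density [w] is the first marginal of the planar Lebesgue
    measure restricted to the region under the graph of [w].  Realizing it this
    way makes it a measure at once, to which the uniqueness of the Lebesgue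
    measure can be applied. *)
Lemma ge0_integral_density (F : R -> \bar R) (w : R -> R) :
  measurable_fun setT F -> (forall x, 0 <= F x) ->
  measurable_fun setT w -> (forall x, (0 <= w x)%R) ->
  forall mE : measurable [set p : R * R | (0 < p.2 <= w p.1)%R],
  \int[mrestr (mu \x mu) mE]_p F p.1 = \int[mu]_x (F x * (w x)%:E).
Proof.
move=> mF F0 mw w0 mE.
have mF1 : measurable_fun [set: R * R] (F \o fst) by exact: measurableT_comp.
rewrite ge0_integral_mrestr//.
rewrite integral_mkcond fubini_tonelli1; first last.
- by move=> x; apply: erestrict_ge0.
- apply/(measurable_restrictT _ _).1 => //.
  exact: measurable_funTS.
apply: eq_integral => x _; rewrite /fubini_F /=.
transitivity (\int[mu]_(y in `]0%R, w x]%classic) (cst (F x) y)); last first.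
  rewrite integral_cst//= lebesgue_measure_itv/= lte_fin.
  case: ltgtP (w0 x) => //= [wx _|<- _]; last by rewrite mule0.
  by rewrite oppr0 adde0.
rewrite [RHS]integral_mkcond; apply: eq_integral => y _.
by rewrite /patch; congr (if _ then _ else _).
Qed.

Lemma measurable_subgraph (w : R -> R) : measurable_fun setT w ->
  measurable [set p : R * R | (0 < p.2 <= w p.1)%R].
Proof.
move=> mw; have mp : measurable_fun setT
    (fun p : R * R => (0 < p.2) && (p.2 <= w p.1))%R.
  apply: measurable_and; first exact: measurable_fun_ltr.
  by apply: measurable_fun_ler => //; exact: measurableT_comp.
have -> : [set p : R * R | (0 < p.2 <= w p.1)%R] =
  setT `&` (fun p : R * R => (0 < p.2) && (p.2 <= w p.1))%R @^-1` [set true].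
  by apply/seteqP; split => p //= [].
exact: mp.
Qed.

Lemma continuous_sec2 (t : R) : (cos t != 0)%R ->
  {for t, continuous (fun t : R => cos t ^- 2)%R}.
Proof.
move=> ct; apply: (@continuousV _ _ (fun t : R => cos t ^+ 2)%R t).
  by rewrite expf_neq0.
rewrite (_ : (fun t : R => cos t ^+ 2)%R = (fun t : R => cos t * cos t)%R).
  by apply: continuousM; exact: continuous_cos.
by apply/funext => u; rewrite expr2.
Qed.

Lemma measurable_sec2_half : measurable_fun setT
  (fun t : R => (\1_Ihalf t * cos t ^- 2)%R).
Proof.
have mI : measurable Ihalf by exact: measurable_itv.
rewrite (_ : (fun _ => _) = ((fun t : R => cos t ^- 2) \_ Ihalf)%R); last first.
  by apply/funext => t; rewrite /patch indicE; case: ifP => _; rewrite ?mul1r ?mul0r.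
apply/(measurable_restrictT _ _).1 => //.
apply: subspace_continuous_measurable_fun => //.
apply: continuous_in_subspaceT => t; rewrite inE/= in_itv/= => tI.
by apply: continuous_sec2; rewrite gt_eqF// cos_gt0_pihalf.
Qed.

Lemma measurable_tan_half : measurable_fun setT
  (fun t : R => (tan t * \1_Ihalf t)%R).
Proof.
have mI : measurable Ihalf by exact: measurable_itv.
rewrite (_ : (fun _ => _) = (@tan R \_ Ihalf)%R); last first.
  by apply/funext => t; rewrite /patch indicE; case: ifP => _; rewrite ?mulr1 ?mulr0.
apply/(measurable_restrictT _ _).1 => //.
apply: subspace_continuous_measurable_fun => //.
apply: continuous_in_subspaceT => t; rewrite inE/= in_itv/= => tI.
by apply: continuous_tan; rewrite gt_eqF// cos_gt0_pihalf.
Qed.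

(** The derivative of tan is sec^2, so the measure sec^2(t) dt on
    ]-pi/2, pi/2[ gives the tan-preimage of ]a, b] the mass b - a. *)
Lemma integral_sec2 (a b : R) : (a < b)%R ->
  \int[mu]_(t in `]atan a, atan b]) (cos t ^- 2)%:E = (b - a)%:E.
Proof.
move=> ab; have ab' : (atan a < atan b)%R by exact: lt_atan.
have cos0 t : t \in `[atan a, atan b]%R -> (cos t != 0)%R.
  rewrite in_itv/= => /andP[ta tb]; rewrite gt_eqF// cos_gt0_pihalf//.
  by rewrite (lt_le_trans (atan_gtNpi2 _) ta) (le_lt_trans tb (atan_ltpi2 _)).
have ccos : {within `[atan a, atan b], continuous (fun t : R => cos t ^- 2)%R}.
  apply: continuous_in_subspaceT => t; rewrite inE/= => tI.
  by apply: continuous_sec2; exact: cos0.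
rewrite integral_itv_obnd_cbnd; last first.
  apply/measurable_EFinP.
  apply: (measurable_funS (E := `[atan a, atan b]%classic)) => //.
    by apply: subset_itvr; rewrite bnd_simp.
  exact: subspace_continuous_measurable_fun.
rewrite (@continuous_FTC2 _ _ tan)//.
- by rewrite !atanK.
- have ctan x : x \in `[atan a, atan b]%R -> {for x, continuous (@tan R)}.
    by move=> xI; apply: continuous_tan; exact: cos0.
  split.
  + move=> x xI; apply: derivable_tan; apply: cos0.
    exact: subset_itv_oo_cc.
  + by apply: cvg_at_right_filter; apply: ctan; rewrite in_itv/= lexx ltW.
  + by apply: cvg_at_left_filter; apply: ctan; rewrite in_itv/= lexx ltW.
- move=> x xI; rewrite derive1E; apply: (@derive_val _ _ _ _ _ _ _ (is_derive_tan _)).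
  by apply: cos0; exact: subset_itv_oo_cc.
Qed.

(** By [integral_sec2] the image under tan of the measure sec^2(t) dt agrees
    with the Lebesgue measure on half-open intervals, hence everywhere. *)
Lemma ge0_integral_tan (G : R -> \bar R) :
  measurable_fun setT G -> (forall x, 0 <= G x) ->
  \int[mu]_x (G (tan x) * (\1_Ihalf x * cos x ^- 2)%:E) =
  \int[mu]_x G x.
Proof.
move=> mG G0.
pose w t : R := (\1_Ihalf t * cos t ^- 2)%R.
pose T t : R := (tan t * \1_Ihalf t)%R.
have w0 t : (0 <= w t)%R by rewrite mulr_ge0// invr_ge0 sqr_ge0.
have mw : measurable_fun setT w by exact: measurable_sec2_half.
have mT : @measurable_fun _ _ (measurableTypeR R) (measurableTypeR R) setT T.
  exact: measurable_tan_half.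
have mE := @measurable_subgraph w mw.
have mT1 : @measurable_fun _ _ (measurableTypeR R * measurableTypeR R)%type
   (measurableTypeR R) setT (T \o fst) by exact: measurableT_comp.
pose m : {measure set (measurableTypeR R) -> \bar R} :=
  measure_function_pushforward__canonical__measure_function_Measure
    (mrestr (mu \x mu) mE) mT1.
have mH (H : R -> \bar R) : measurable_fun setT H -> (forall x, 0 <= H x) ->
    \int[m]_x H x = \int[mu]_x (H (T x) * (w x)%:E).
  move=> mH H0; rewrite ge0_integral_pushforward//=.
  rewrite -(@ge0_integral_density (H \o T) w _ _ _ _ mE)//.
    exact: measurableT_comp.
  by move=> x; exact: H0.
transitivity (\int[m]_x G x).
  rewrite mH//; apply: eq_integral => x _; rewrite /w /T indicE.
  by case: (x \in _); rewrite ?mulr1// mul0r !mule0.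
apply: eq_measure_integral => A mA _; apply/esym.
apply: lebesgue_measure_unique => // _ [[a b]] _ <-.
have -> : m [set` `](a, b).1, (a, b).2]] =
    \int[m]_x (\1_[set` `](a, b).1, (a, b).2]] x)%:E.
  by rewrite integral_indic// setIT.
rewrite mH; last 2 first.
- by apply/measurable_EFinP; exact: measurable_indic.
- by move=> x; rewrite lee_fin.
have [ab|ba] := ltP a b; last first.
  rewrite set_itv_ge -?leNgt ?bnd_simp// measure0 integral0_eq// => x _.
  by rewrite indic0 mul0e.
rewrite lebesgue_measure_itv/= lte_fin ab -EFinB -integral_sec2// integral_mkcond.
apply: eq_integral => x _; rewrite /patch /w /T !indicE -EFinM !mem_setE.
case: (boolP (x \in `](- (pi / 2)), (pi / 2)[%R)) => [xI|xI]; last first.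
  rewrite !(mul0r, mulr0) ifF//; apply: contraNF xI.
  rewrite !in_itv/= => /andP[ax xb].
  by rewrite (lt_trans (atan_gtNpi2 _) ax) (le_lt_trans xb (atan_ltpi2 _)).
rewrite mulr1 mul1r (_ : (tan x \in _) = (x \in `]atan a, atan b]%classic)); last first.
  rewrite ?mem_setE !in_itv/= !ltNge.
  have atanI (z : R) : (atan z \in `](- (pi / 2)), (pi / 2)[)%R.
    by rewrite in_itv/= atan_gtNpi2 atan_ltpi2.
  rewrite -{1}(atanK a) -{1}(atanK b).
  have le_tan : ({in `](- (pi / 2)), (pi / 2)[ &, {mono @tan R : x y / x <= y}})%R.
    by move=> u v uI vI; rewrite !leNgt ltr_tan.
  by rewrite !le_tan.
by rewrite mem_setE; case: ifP => _; rewrite ?mul1r ?mul0r.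
Qed.

End tangent_substitution.

(** * Polar coordinates *)

Lemma measurable_sin (R : realType) : measurable_fun setT (@sin R).
Proof. by apply: continuous_measurable_fun; exact: continuous_sin. Qed.

Lemma measurable_cos (R : realType) : measurable_fun setT (@cos R).
Proof. by apply: continuous_measurable_fun; exact: continuous_cos. Qed.

Lemma measurable_sqrt (R : realType) : measurable_fun setT (@Num.sqrt R).
Proof. by apply: continuous_measurable_fun; exact: sqrt_continuous. Qed.

(** Measurability of expressions built from measurable functions, by recursion on
    the body of the function; the hypotheses of the context provide the atoms. *)
Ltac solve_measurable := lazy beta; lazymatch goal with
  | |- measurable_fun _ (fun=> ?c) => exact: measurable_cst
  | |- measurable_fun _ (fun x => (@?f x)%:E) => apply/measurable_EFinP; solve_measurable
  | |- measurable_fun _ (fun x => (@?f x * @?g x)%E) =>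
      apply: (@emeasurable_funM _ _ _ _ f g); solve_measurable
  | |- measurable_fun _ (fun x => (@?f x * @?g x)%R) =>
      apply: (@measurable_funM _ _ _ _ f g); solve_measurable
  | |- measurable_fun _ (fun x => (@?f x + @?g x)%R) =>
      first [ apply: (@measurable_funD _ _ _ _ f g)
            | apply: (@emeasurable_funD _ _ _ _ f g) ]; solve_measurable
  | |- measurable_fun _ (fun x => (- @?f x)%R) =>
      apply: (@measurable_funN _ _ _ _ f); solve_measurable
  | |- measurable_fun _ (fun x => (@?f x ^+ _)%R) =>
      apply: (@measurable_funX _ _ _ _ f); solve_measurable
  | |- measurable_fun _ ( *%R ?a) =>
      apply: (@measurable_funM _ _ _ _ (cst a) id); solve_measurable
  | |- measurable_fun _ (+%R ?a) =>
      apply: (@measurable_funD _ _ _ _ (cst a) id); solve_measurable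
  | |- measurable_fun _ (fun x => (@?f x, @?g x)) =>
      apply: (@measurable_fun_pair _ _ _ _ _ _ f g); solve_measurable
  | |- measurable_fun _ (pair ?a) =>
      apply: (@measurable_fun_pair _ _ _ _ _ _ (cst a) id); solve_measurable
  | |- measurable_fun _ (fun x => (@?f x).1) =>
      apply: (measurableT_comp (g := f) (f := fst) measurable_fst); solve_measurable
  | |- measurable_fun _ (fun x => (@?f x).2) =>
      apply: (measurableT_comp (g := f) (f := snd) measurable_snd); solve_measurable
  | |- measurable_fun _ (fun x => sin (@?f x)) =>
      apply: (measurableT_comp (g := f) (f := sin) (@measurable_sin _)); solve_measurable
  | |- measurable_fun _ (fun x => cos (@?f x)) =>
      apply: (measurableT_comp (g := f) (f := cos) (@measurable_cos _)); solve_measurable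
  | |- measurable_fun _ (fun x => Num.sqrt (@?f x)) =>
      apply: (measurableT_comp (g := f) (@measurable_sqrt _)); solve_measurable
  | |- measurable_fun _ (fun x => `|@?f x|%E) =>
      apply: (measurableT_comp (g := f) (f := abse)); [done | solve_measurable]
  | |- measurable_fun _ (fun x => `|@?f x|%R) =>
      apply: (measurableT_comp (g := f) (@normr_measurable _ setT)); solve_measurable
  | |- measurable_fun _ (fun x => @indic ?A ?B ?I (@?f x)) =>
      apply: (measurableT_comp (f := @indic A B I) (g := f));
      [exact: measurable_indic | solve_measurable]
  | H : measurable_fun _ ?F |- measurable_fun _ (fun x => ?F (@?f x)) =>
      apply: (measurableT_comp (g := f) (f := F) H); solve_measurable
  | |- _ => solve [ exact: measurable_cst | exact: measurable_id | assumption | done ]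
  end.

Section polar_coordinates.
Context {R : realType}.
Local Notation mu := (@lebesgue_measure R).
Local Notation Ihalf := ([set` `](- (pi / 2)), (pi / 2)[%R] : set R).
Local Notation Ipi := ([set` `]0, pi[%R] : set R).
Local Notation I2pi := ([set` `]0, (2 * pi)[%R] : set R).
Local Notation Ipos := ([set` `]0, +oo[%R] : set R).
Local Open Scope ereal_scope.

Lemma ge0_integral_reflect (f : R -> \bar R) (c : R) :
  measurable_fun setT f -> (forall x, 0 <= f x) ->
  \int[mu]_t f (- t + c)%R = \int[mu]_t f t.
Proof.
move=> mf f0; have mfc : measurable_fun setT (fun t : R => f (t + c)%R) by solve_measurable.
have := ge0_integral_opp mfc (fun t : R => f0 (t + c)%R).
by rewrite ge0_integral_shift.
Qed.

(** The angle [t] is measured from the second axis, which is the convention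
    needed for the polar angle of spherical coordinates. *)
Lemma ge0_integral_right_half_plane (g : R * R -> \bar R) :
  measurable_fun setT g -> (forall p, 0 <= g p) ->
  \int[mu]_x \int[mu]_y ((\1_Ipos x)%:E * g (x, y)) =
  \int[mu]_r \int[mu]_t
    ((\1_Ipos r * \1_Ipi t * r)%:E * g (r * sin t, r * cos t)%R).
Proof.
move=> mg g0.
pose w t : R := (\1_Ihalf t * cos t ^- 2)%R.
pose T t : R := (tan t * \1_Ihalf t)%R.
have mw : measurable_fun setT w by exact: measurable_sec2_half.
have mT : measurable_fun setT T by exact: measurable_tan_half.
have w0 t : (0 <= w t)%R by rewrite mulr_ge0// invr_ge0 sqr_ge0.
have P0 x : (0 <= \1_Ipos x * x :> R)%R.
  rewrite indicE mem_setE in_itv/= andbT; case: ltP => x0; last by rewrite mul0r.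
  by rewrite mul1r ltW.
have tanE (G : R -> \bar R) : measurable_fun setT G -> (forall x, 0 <= G x) ->
    \int[mu]_t G t = \int[mu]_t ((w t)%:E * G (T t)).
  move=> mG G0; rewrite -ge0_integral_tan//; apply: eq_integral => t _.
  rewrite /T /w indicE muleC.
  by case: (_ \in _); rewrite ?mulr1// !mul0r !mul0e.
(* Substitute y = x tan phi for fixed x. *)
transitivity (\int[mu]_x \int[mu]_t
    ((\1_Ipos x * x * w t)%:E * g (x, x * T t)%R)).
  apply: eq_integral => x _.
  case: (ltP 0%R x) => x0; last first.
    have x0' : \1_Ipos x = 0%R :> R by rewrite indicE mem_setE in_itv/= ltNge x0.
    by rewrite !integral0_eq// => t _; rewrite x0' ?mul0r mul0e.
  have -> : \1_Ipos x = 1%R :> R by rewrite indicE mem_setE in_itv/= x0.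
  under eq_integral do rewrite mul1e.
  have mgx : measurable_fun setT (fun t => g (x, t)) by solve_measurable.
  have mgxx : measurable_fun setT (fun t => g (x, x * t)%R) by solve_measurable.
  rewrite -(@ge0_integral_scale _ (fun y => g (x, y)) x)//.
  rewrite (tanE (fun y => g (x, x * y)%R))// -ge0_integralZl//=; last 3 first.
  - by solve_measurable.
  - by move=> t _; rewrite mule_ge0// lee_fin w0.
  - by rewrite lee_fin ltW.
  by apply: eq_integral => t _; rewrite mul1r muleA EFinM.
rewrite [LHS](fubini_tonelli (m1 := mu) (m2 := mu) (fun p : R * R =>
   ((\1_Ipos p.1 * p.1 * w p.2)%:E * g (p.1, p.1 * T p.2)%R)))/=; last 2 first.
- solve_measurable.
- by move=> p; rewrite mule_ge0// lee_fin mulr_ge0 ?P0 ?w0.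
(* After Tonelli, substitute x = r cos phi for fixed phi. *)
transitivity (\int[mu]_t \int[mu]_r
    ((\1_Ipos r * \1_Ihalf t * r)%:E * g (r * cos t, r * sin t)%R)).
  apply: eq_integral => t _.
  have [tI|tI] := boolP (t \in Ihalf); last first.
    have t0 : \1_Ihalf t = 0%R :> R by rewrite indicE (negbTE tI).
    by rewrite !integral0_eq// => x _; rewrite /w t0 !(mul0r, mulr0) mul0e.
  have t1 : \1_Ihalf t = 1%R :> R by rewrite indicE tI.
  have c0 : (0 < cos t)%R.
    by move: tI; rewrite inE/= in_itv/= => tI; exact: cos_gt0_pihalf.
  rewrite -[LHS](@ge0_integral_scale _ _ (cos t))//; last 2 first.
  - by solve_measurable.
  - by move=> x; rewrite mule_ge0// lee_fin mulr_ge0 ?P0 ?w0.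
  rewrite -ge0_integralZl//=; last 3 first.
  - by solve_measurable.
  - by move=> x _; rewrite mule_ge0// lee_fin mulr_ge0 ?P0 ?w0.
  - by rewrite lee_fin ltW.
  apply: eq_integral => r _.
  rewrite muleA -EFinM /w /T t1 !(mul1r, mulr1).
  have -> : \1_Ipos (cos t * r)%R = \1_Ipos r :> R.
    by rewrite !indicE !mem_setE !in_itv/= !andbT pmulr_rgt0.
  congr (_%:E * g (_, _)).
  - by field; rewrite gt_eqF.
  - by rewrite mulrC.
  - by rewrite /tan; field; rewrite gt_eqF.
(* Pass to the complementary angle phi = pi/2 - t. *)
pose H t : \bar R := \int[mu]_r
    ((\1_Ipos r * \1_Ihalf t * r)%:E * g (r * cos t, r * sin t)%R).
have mH : measurable_fun setT H.
  apply: (measurable_fun_fubini_tonelli_F (T1 := measurableTypeR R) (m2 := mu) (fun p : R * R =>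
    ((\1_Ipos p.2 * \1_Ihalf p.1 * p.2)%:E * g (p.2 * cos p.1, p.2 * sin p.1)%R))).
    by solve_measurable.
  by move=> p; rewrite mule_ge0// lee_fin mulrAC mulr_ge0 ?P0.
have H0 t : 0 <= H t.
  by apply: integral_ge0 => r _; rewrite mule_ge0// lee_fin mulrAC mulr_ge0 ?P0.
transitivity (\int[mu]_t H (- t + pi / 2)%R).
  exact/esym/ge0_integral_reflect.
rewrite [RHS](fubini_tonelli (m1 := mu) (m2 := mu) (fun p : R * R =>
    ((\1_Ipos p.1 * \1_Ipi p.2 * p.1)%:E * g (p.1 * sin p.2, p.1 * cos p.2)%R)))/=; last 2 first.
- by solve_measurable.
- by move=> p; rewrite mule_ge0// lee_fin mulrAC mulr_ge0 ?P0.
apply: eq_integral => t _; apply: eq_integral => r _.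
rewrite (addrC (- t)%R) -(opprB t) cosN sinN cosBpihalf sinBpihalf opprK.
congr ((_ * _%:R * _)%:E * _); rewrite !mem_setE !in_itv/=.
by congr nat_of_bool; apply/idP/idP => /andP[? ?]; apply/andP; split; lra.
Qed.

Lemma integral_eq_off1 (f g : R -> \bar R) (c : R) :
  measurable_fun setT f -> measurable_fun setT g ->
  (forall x, x != c -> f x = g x) -> \int[mu]_x f x = \int[mu]_x g x.
Proof.
move=> mf mg fg.
have mc : measurable (setT `\ c) by exact: measurableD.
rewrite -(@integral_setD1 _ f c setT)//; last exact: measurable_funTS.
rewrite -(@integral_setD1 _ g c setT)//; last exact: measurable_funTS.
by apply: eq_integral => x; rewrite inE => -[_ /eqP]; exact: fg.
Qed.

Lemma ge0_integral_upper_half_plane (g : R * R -> \bar R) :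
  measurable_fun setT g -> (forall p, 0 <= g p) ->
  \int[mu]_x \int[mu]_y ((\1_Ipos y)%:E * g (x, y)) =
  \int[mu]_r \int[mu]_t
    ((\1_Ipos r * \1_Ipi t * r)%:E * g (r * cos t, r * sin t)%R).
Proof.
move=> mg g0.
rewrite (fubini_tonelli (m1 := mu) (m2 := mu)
  (fun p : R * R => (\1_Ipos p.2)%:E * g (p.1, p.2))); last 2 first.
- by solve_measurable.
- by move=> p; rewrite mule_ge0// lee_fin.
rewrite /= (ge0_integral_right_half_plane (g := fun p => g (p.2, p.1)))//.
by solve_measurable.
Qed.

(** The upper half-plane contributes the angles in ]0, pi[; the lower one is its
    image under the central symmetry, which adds pi to the angle. *)
Lemma ge0_integral_polar (g : R * R -> \bar R) :
  measurable_fun setT g -> (forall p, 0 <= g p) ->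
  \int[mu]_x \int[mu]_y g (x, y) =
  \int[mu]_r \int[mu]_t
    ((\1_Ipos r * \1_I2pi t * r)%:E * g (r * cos t, r * sin t)%R).
Proof.
move=> mg g0.
have mgN : measurable_fun setT (fun p : R * R => g (- p.1, - p.2)%R) by solve_measurable.
have mgx x : measurable_fun setT (fun y => g (x, y)) by solve_measurable.
have mgp : measurable_fun setT (fun p : R * R => g (p.1, p.2)%R) by solve_measurable.
have P0 x : (0 <= \1_Ipos x * x :> R)%R.
  rewrite indicE mem_setE in_itv/= andbT; case: ltP => x0; last by rewrite mul0r.
  by rewrite mul1r ltW.
transitivity (\int[mu]_x \int[mu]_y ((\1_Ipos y)%:E * g (x, y)) +
  \int[mu]_x \int[mu]_y ((\1_Ipos y)%:E * g (- x, - y)%R)).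
  rewrite -(@ge0_integral_opp _ (fun x => \int[mu]_y ((\1_Ipos y)%:E * g (- x, - y)%R))); last 2 first.
  - apply: (measurable_fun_fubini_tonelli_F (T1 := measurableTypeR R)
      (m2 := mu) (fun p : R * R => (\1_Ipos p.2)%:E * g (- p.1, - p.2)%R)).
      by solve_measurable.
    by move=> p; rewrite mule_ge0// lee_fin.
  - by move=> x; apply: integral_ge0 => y _; rewrite mule_ge0// lee_fin.
  rewrite -ge0_integralD//; last 4 first.
  - by move=> x _; apply: integral_ge0 => y _; rewrite mule_ge0// lee_fin.
  - apply: (measurable_fun_fubini_tonelli_F (T1 := measurableTypeR R)
      (m2 := mu) (fun p : R * R => (\1_Ipos p.2)%:E * g (p.1, p.2)%R)).
      by solve_measurable.
    by move=> p; rewrite mule_ge0// lee_fin.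
  - by move=> x _; apply: integral_ge0 => y _; rewrite mule_ge0// lee_fin.
  - apply: (measurable_fun_fubini_tonelli_F (T1 := measurableTypeR R)
      (m2 := mu) (fun p : R * R => (\1_Ipos p.2)%:E * g (- - p.1, - p.2)%R)).
      by solve_measurable.
    by move=> p; rewrite mule_ge0// lee_fin.
  apply: eq_integral => x _; rewrite opprK.
  rewrite -(@ge0_integral_opp _ (fun y => (\1_Ipos y)%:E * g (x, - y)%R)); last 2 first.
  - by solve_measurable.
  - by move=> y; rewrite mule_ge0// lee_fin.
  rewrite -ge0_integralD//; last 4 first.
  - by move=> y _; rewrite mule_ge0// lee_fin.
  - by solve_measurable.
  - by move=> y _; rewrite mule_ge0// lee_fin.
  - by solve_measurable.
  apply: (@integral_eq_off1 _ _ 0%R); [by solve_measurable|by solve_measurable|].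
  move=> y y0; rewrite opprK -ge0_muleDl ?lee_fin// -EFinD !indicE !mem_setE.
  by rewrite !in_itv/= !andbT oppr_gt0; case: ltgtP y0; rewrite ?(addr0, add0r) ?mul1e.
rewrite ge0_integral_upper_half_plane// (ge0_integral_upper_half_plane (g := fun p => g (- p.1, - p.2)%R))//.
rewrite -ge0_integralD//; last 4 first.
- by move=> x _; apply: integral_ge0 => y _; rewrite mule_ge0// lee_fin mulrAC mulr_ge0.
- apply: (measurable_fun_fubini_tonelli_F (T1 := measurableTypeR R)
    (m2 := mu) (fun p : R * R => (\1_Ipos p.1 * \1_Ipi p.2 * p.1)%:E *
      g (p.1 * cos p.2, p.1 * sin p.2)%R)).
    by solve_measurable.
  by move=> p; rewrite mule_ge0// lee_fin mulrAC mulr_ge0.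
- by move=> x _; apply: integral_ge0 => y _; rewrite mule_ge0// lee_fin mulrAC mulr_ge0.
- apply: (measurable_fun_fubini_tonelli_F (T1 := measurableTypeR R)
    (m2 := mu) (fun p : R * R => (\1_Ipos p.1 * \1_Ipi p.2 * p.1)%:E *
      g (- (p.1 * cos p.2), - (p.1 * sin p.2))%R)).
    by solve_measurable.
  by move=> p; rewrite mule_ge0// lee_fin mulrAC mulr_ge0.
apply: eq_integral => r _ /=.
pose H t := (\1_Ipos r * \1_[set` `]pi, (2 * pi)[%R] t * r)%:E * g (r * cos t, r * sin t)%R.
have mH : measurable_fun setT H by rewrite /H; solve_measurable.
have W0 (A : set R) (t : R) : (0 <= \1_Ipos r * \1_A t * r :> R)%R.
  by rewrite mulrAC mulr_ge0.
have H0 t : 0 <= H t by apply: mule_ge0 => //; rewrite lee_fin.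
transitivity (\int[mu]_t ((\1_Ipos r * \1_Ipi t * r)%:E * g (r * cos t, r * sin t)%R) +
   \int[mu]_t H t).
  congr (_ + _); apply/esym.
  have <- := ge0_integral_shift pi mH H0.
  apply: eq_integral => t _; rewrite /H cosDpi sinDpi !mulrN.
  congr ((_ * _%:R * _)%:E * _); rewrite !mem_setE !in_itv/=.
  by congr nat_of_bool; apply/idP/idP => /andP[? ?]; apply/andP; split; lra.
rewrite -ge0_integralD//; last 2 first.
- by move=> t _; apply: mule_ge0 => //; rewrite lee_fin.
- by solve_measurable.
apply: (@integral_eq_off1 _ _ pi); [by rewrite /H; solve_measurable|by solve_measurable|].
move=> t tpi; rewrite /H -ge0_muleDl ?lee_fin//.
rewrite -EFinD -mulrDl -mulrDr; congr ((_ * _ * _)%:E * _).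
rewrite !indicE !mem_setE !in_itv/=.
have pi0 := pi_gt0 R.
case: (ltgtP t pi) tpi => // tpi _.
  by rewrite andbT (lt_trans tpi) ?andbT ?addr0// mulr_natl mulr2n ltrDl.
by rewrite (lt_trans pi0 tpi)/= add0r.
Qed.

End polar_coordinates.

(** * Spherical coordinates *)

Section product_sigma_finite.
Local Open Scope ereal_scope.
Context d1 d2 (T1 : measurableType d1) (T2 : measurableType d2) (R : realType).
Variable m1 : {sigma_finite_measure set T1 -> \bar R}.
Variable m2 : {sigma_finite_measure set T2 -> \bar R}.

Lemma product_measure1_sigma_finite : sigma_finite setT (m1 \x m2).
Proof.
have /sigma_finiteP[F [TF ndF Foo]] := sigma_finiteT m1.
have /sigma_finiteP[G [TG ndG Goo]] := sigma_finiteT m2.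
exists (fun n => F n `*` G n).
  rewrite -setXTT TF TG predeqE => -[x y]; split.
    move=> [/= [n _ Fnx] [k _ Gky]]; exists (maxn n k) => //; split.
    - by move: x Fnx; exact/subsetPset/ndF/leq_maxl.
    - by move: y Gky; exact/subsetPset/ndG/leq_maxr.
  by move=> [n _ []/= ? ?]; split; exists n.
move=> k; have [? ?] := Foo k; have [? ?] := Goo k.
split; first exact: measurableX.
by rewrite product_measure1E// lte_mul_pinfty// ge0_fin_numE.
Qed.

(** The product measure packed with its sigma-finiteness, so that Fubini applies
    to products of more than two factors. *)
Definition sigma_finite_product :
    {sigma_finite_measure set (T1 * T2)%type -> \bar R} :=
  HB.pack_for {sigma_finite_measure set (T1 * T2)%type -> \bar R} (m1 \x m2)
    (Measure_isSigmaFinite.Build _ _ _ (m1 \x m2) product_measure1_sigma_finite).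

End product_sigma_finite.

Definition lebesgue2 (R : realType) :=
  sigma_finite_product (@lebesgue_measure R) (@lebesgue_measure R).

Definition sf_lebesgue3 (R : realType) :=
  sigma_finite_product (lebesgue2 R) (@lebesgue_measure R).

Section spherical_coordinates.
Context {R : realType}.
Local Notation mu := (@lebesgue_measure R).
Local Notation Ipi := ([set` `]0, pi[%R] : set R).
Local Notation I2pi := ([set` `]0, (2 * pi)[%R] : set R).
Local Notation Ipos := ([set` `]0, +oo[%R] : set R).
Local Notation X3 := (measurableTypeR R * measurableTypeR R * measurableTypeR R)%type.

Definition spherical (p : R * R * R) : R * R * R :=
  (p.1.1 * sin p.1.2 * cos p.2, p.1.1 * sin p.1.2 * sin p.2, p.1.1 * cos p.1.2).

(** The indicators restrict the parameters to the open box that [spherical] maps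
    injectively onto the complement of a null set, so that the change of
    variables can be stated on the whole space. *)
Definition spherical_jacobian (p : R * R * R) : R :=
  \1_Ipos p.1.1 * \1_Ipi p.1.2 * \1_I2pi p.2 * (p.1.1 ^+ 2 * sin p.1.2).

Lemma spherical_jacobian_ge0 p : 0 <= spherical_jacobian p.
Proof.
rewrite /spherical_jacobian.
have : 0 <= \1_Ipi p.1.2 * sin p.1.2 :> R.
  rewrite indicE mem_setE in_itv/=.
  by have [/sin_gt0_pi/ltW|] := boolP (0 < p.1.2 < pi); rewrite ?mul1r ?mul0r.
move=> s0; rewrite (_ : _ * _ = \1_Ipos p.1.1 * \1_I2pi p.2 * p.1.1 ^+ 2 *
  (\1_Ipi p.1.2 * sin p.1.2)); last by ring.
by apply: mulr_ge0 => //; apply: mulr_ge0; [exact: mulr_ge0|exact: sqr_ge0].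
Qed.

Local Open Scope ereal_scope.

Lemma ge0_integral_lebesgue3 (f : X3 -> \bar R) :
  measurable_fun setT f -> (forall p, 0 <= f p) ->
  \int[lebesgue3 R]_p f p =
  \int[mu]_x \int[mu]_y \int[mu]_z f (x, y, z).
Proof.
move=> mf f0.
rewrite /lebesgue3 (fubini_tonelli1 (m1 := lebesgue2 R) (m2 := mu))//.
rewrite (fubini_tonelli1 (m1 := mu) (m2 := mu))//.
- exact: (measurable_fun_fubini_tonelli_F (m2 := mu)).
- by move=> x; exact: integral_ge0.
Qed.

(** Polar coordinates in the horizontal plane leave the half-plane of the pairs
    (distance to the vertical axis, height); polar coordinates there give the
    radius and the polar angle. *)
Lemma ge0_integral_spherical (f : X3 -> \bar R) :
  measurable_fun setT f -> (forall p, 0 <= f p) ->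
  \int[lebesgue3 R]_s f s =
  \int[lebesgue3 R]_p ((spherical_jacobian p)%:E * f (spherical p)).
Proof.
move=> mf f0.
have P0 (x : R) : (0 <= \1_Ipos x * x)%R.
  rewrite indicE mem_setE in_itv/= andbT; case: ltP => x0; last by rewrite mul0r.
  by rewrite mul1r ltW.
rewrite [LHS](fubini_tonelli2 (m1 := lebesgue2 R) (m2 := mu))//.
pose G (p : R * R) := \int[mu]_t
  ((\1_Ipos p.1 * \1_I2pi t * p.1)%:E * f (p.1 * cos t, p.1 * sin t, p.2)%R).
transitivity (\int[mu]_z \int[mu]_x G (x, z)).
  apply: eq_integral => z _; rewrite /fubini_G (fubini_tonelli1 (m1 := mu) (m2 := mu))//; last by solve_measurable.
  rewrite /fubini_F (ge0_integral_polar (g := fun p => f (p.1, p.2, z)))//.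
  by solve_measurable.
have mG : measurable_fun setT G.
  apply: (measurable_fun_fubini_tonelli_F
    (T1 := (measurableTypeR R * measurableTypeR R)%type) (m2 := mu)
    (fun q : R * R * R => (\1_Ipos q.1.1 * \1_I2pi q.2 * q.1.1)%:E *
       f (q.1.1 * cos q.2, q.1.1 * sin q.2, q.1.2)%R)).
    by solve_measurable.
  by move=> q; apply: mule_ge0 => //; rewrite lee_fin mulrAC mulr_ge0.
have G0 p : 0 <= G p.
  by apply: integral_ge0 => t _; apply: mule_ge0 => //; rewrite lee_fin mulrAC mulr_ge0.
transitivity (\int[mu]_x \int[mu]_y ((\1_Ipos x)%:E * G (x, y))).
  rewrite (fubini_tonelli (m1 := mu) (m2 := mu)
    (fun p : R * R => (\1_Ipos p.1)%:E * G (p.1, p.2))); last 2 first.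
  - by solve_measurable.
  - by move=> p; apply: mule_ge0 => //; rewrite lee_fin.
  apply: eq_integral => z _; apply: eq_integral => x _ /=.
  case: (boolP (x \in Ipos)) => xI; first by rewrite indicE xI mul1e.
  rewrite indicE (negbTE xI) mul0e; apply: integral0_eq => t _ /=.
  by rewrite indicE (negbTE xI) !mul0r mul0e.
rewrite ge0_integral_right_half_plane//.
have mJf : measurable_fun setT (fun p : R * R * R =>
    (spherical_jacobian p)%:E * f (spherical p)).
  by rewrite /spherical_jacobian /spherical; solve_measurable.
rewrite -/(lebesgue3 R) ge0_integral_lebesgue3//; last first.
  by move=> p; apply: mule_ge0 => //; rewrite lee_fin spherical_jacobian_ge0.
apply: eq_integral => r _; apply: eq_integral => t _.
rewrite /G -ge0_integralZl//=; last 3 first.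
- by solve_measurable.
- by move=> u _; apply: mule_ge0 => //; rewrite lee_fin mulrAC mulr_ge0.
- by rewrite lee_fin mulrAC mulr_ge0// P0.
apply: eq_integral => u _; rewrite muleA -EFinM /spherical/=.
congr (_%:E * _); rewrite /spherical_jacobian/=.
rewrite !indicE !mem_setE !in_itv/= !andbT.
case: (ltP 0%R r) => r0; last by rewrite !mul0r.
have [/sin_gt0_pi s0|_] := boolP (0 < t < pi)%R; last by rewrite mulr0 !mul0r.
by rewrite mulr_gt0// !mul1r; ring.
Qed.

End spherical_coordinates.

(** * From nonnegative to integrable functions *)

(** A substitution rule for nonnegative functions extends to integrable ones,
    because it commutes with positive and negative parts when the weight is
    nonnegative. *)
Section transfer.
Context d d' (X : measurableType d) (Y : measurableType d') (R : realType).
Variables (m : {measure set X -> \bar R}) (m' : {measure set Y -> \bar R}).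
Variables (T : Y -> X) (J : Y -> R).
Hypothesis mT : measurable_fun setT T.
Hypothesis mJ : measurable_fun setT J.
Hypothesis J0 : forall y, 0 <= J y.
Hypothesis mmT : forall f : X -> \bar R, measurable_fun setT f ->
  (forall x, 0 <= f x)%E ->
  (\int[m]_x f x = \int[m']_y ((J y)%:E * f (T y)))%E.
Variable f : X -> R.
Hypothesis fi : m.-integrable setT (EFin \o f).

Lemma integrable_transfer : m'.-integrable setT (EFin \o (fun y => J y * f (T y))).
Proof.
move: fi => /integrableP[mf foo].
have mf' : measurable_fun setT f by exact/measurable_EFinP.
apply/integrableP; split; first by rewrite /comp; solve_measurable.
move: foo; rewrite mmT; last 2 first.
- by apply: measurableT_comp.
- by move=> x; exact: abse_ge0.
apply: le_lt_trans; rewrite le_eqVlt; apply/orP; left; apply/eqP.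
by apply: eq_integral => y _ /=; rewrite normrM (ger0_norm (J0 y)).
Qed.

Lemma Rintegral_transfer :
  \int[m]_x f x = \int[m']_y (J y * f (T y)).
Proof.
move: fi => /integrableP[mf foo].
rewrite /Rintegral; congr fine; rewrite integralE [RHS]integralE; congr (_ - _)%E.
- rewrite mmT//; last exact: measurable_funepos.
  apply: eq_integral => y _.
  by rewrite !funeposE maxe_pMr ?lee_fin// mule0.
- rewrite mmT//; last exact: measurable_funeneg.
  apply: eq_integral => y _.
  by rewrite !funenegE maxe_pMr ?lee_fin// mule0 muleN.
Qed.

End transfer.

(** Partial integrals of an integrable function may be infinite on a null set;
    there the real-valued integral is 0, which changes neither integrability nor
    the value of the iterated integral. *)
Section fubini_Rintegral.
Context d1 d2 (T1 : measurableType d1) (T2 : measurableType d2) (R : realType).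
Variable m1 : {sigma_finite_measure set T1 -> \bar R}.
Variable m2 : {sigma_finite_measure set T2 -> \bar R}.
Variable f : T1 * T2 -> R.
Hypothesis fi : (m1 \x m2)%E.-integrable setT (EFin \o f).

Let fineE d (T : measurableType d) (m : {measure set T -> \bar R}) (F : T -> \bar R) :
  m.-integrable setT F ->
  m.-integrable setT (EFin \o (fine \o F)) /\
  (\int[m]_x (fine (F x))%:E = \int[m]_x F x)%E.
Proof.
move=> Fi; have mF := measurable_int _ Fi.
have mfF : measurable_fun setT (EFin \o (fine \o F)).
  by apply/measurable_EFinP; exact: measurableT_comp.
split.
  apply: le_integrable Fi => // x _ /=.
  by case: (F x) => [r| |] //=; rewrite normr0 leey.
apply: ae_eq_integral => //.
have := integrable_ae measurableT Fi.
by apply: filterS => x /= h _; rewrite fineK// h.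
Qed.

Lemma integrable_Rintegral1 :
  m1.-integrable setT (EFin \o (fun x => \int[m2]_y f (x, y))).
Proof. exact: (fineE (integrable_fubini_F fi)).1. Qed.

Lemma Rintegral_fubini1 :
  \int[(m1 \x m2)%E]_p f p = \int[m1]_x \int[m2]_y f (x, y).
Proof.
rewrite /Rintegral; congr fine.
by rewrite (fineE (integrable_fubini_F fi)).2 -integral12_prod_meas1.
Qed.

Let fi' : (m2 \x m1)%E.-integrable setT (EFin \o (fun p => f (p.2, p.1))).
Proof.
have mf : measurable_fun setT f by move: fi => /measurable_int /measurable_EFinP.
apply/integrable12ltyP; first by rewrite /comp; solve_measurable.
by move/(integrable21ltyP _ _ (measurable_int _ fi)): fi.
Qed.

Lemma integrable_Rintegral2 :
  m2.-integrable setT (EFin \o (fun y => \int[m1]_x f (x, y))).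
Proof.
exact: (fineE (integrable_fubini_F fi')).1.
Qed.

Lemma Rintegral_fubini2 :
  \int[(m1 \x m2)%E]_p f p = \int[m2]_y \int[m1]_x f (x, y).
Proof.
rewrite /Rintegral; congr fine.
rewrite (fineE (integrable_fubini_F fi')).2.
exact/esym/(integral21_prod_meas1 fi).
Qed.

End fubini_Rintegral.

Section reflections.
Context {R : realType}.
Local Notation mu := (@lebesgue_measure R).
Local Open Scope ereal_scope.

Local Notation X3 := (measurableTypeR R * measurableTypeR R * measurableTypeR R)%type.

Definition reflect3 (b : bool * bool * bool) (s : R * R * R) : R * R * R :=
  ((-1) ^+ b.1.1 * s.1.1, (-1) ^+ b.1.2 * s.1.2, (-1) ^+ b.2 * s.2)%R.

Lemma ge0_integral_sign (f : R -> \bar R) (b : bool) :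
  measurable_fun setT f -> (forall x, 0 <= f x) ->
  \int[mu]_x f ((-1) ^+ b * x)%R = \int[mu]_x f x.
Proof.
move=> mf f0; case: b.
  by under eq_integral do rewrite mulN1r; exact: ge0_integral_opp.
by under eq_integral do rewrite mul1r.
Qed.

(** The factor 1 is the weight that the transfer lemmas expect. *)
Lemma ge0_integral_reflect3 (b : bool * bool * bool) (f : X3 -> \bar R) :
  measurable_fun setT f -> (forall s, 0 <= f s) ->
  \int[lebesgue3 R]_s f s = \int[lebesgue3 R]_s (1%:E * f (reflect3 b s)).
Proof.
move=> mf f0; under [RHS]eq_integral do rewrite mul1e.
have mfr : measurable_fun setT (fun s : X3 => f (reflect3 b s)).
  by rewrite /reflect3; solve_measurable.
apply: etrans; first exact: (ge0_integral_lebesgue3 mf f0).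
apply: etrans; last exact: (esym (ge0_integral_lebesgue3 mfr (fun s => f0 _))).
have mF : measurable_fun setT (fun p : R * R => \int[mu]_z f (p, z)).
  exact: (measurable_fun_fubini_tonelli_F
    (T1 := (measurableTypeR R * measurableTypeR R)%type) (m2 := mu)).
have F0 p : 0 <= \int[mu]_z f (p, z) by exact: integral_ge0.
have mG : measurable_fun setT (fun x : R => \int[mu]_y \int[mu]_z f (x, y, z)).
  exact: (measurable_fun_fubini_tonelli_F
    (T1 := measurableTypeR R) (m2 := mu) (fun p => \int[mu]_z f (p, z))).
have G0 x : 0 <= \int[mu]_y \int[mu]_z f (x, y, z) by exact: integral_ge0.
rewrite -(ge0_integral_sign b.1.1 mG G0); apply: eq_integral => x _.
have mH : measurable_fun setT
    (fun y : R => \int[mu]_z f ((-1) ^+ b.1.1 * x, y, z)%R).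
  exact: (measurableT_comp mF (pair1_measurable ((-1) ^+ b.1.1 * x)%R)).
rewrite -(ge0_integral_sign b.1.2 mH) => [|y]; last exact: F0.
apply: eq_integral => y _.
have mK : measurable_fun setT
    (fun z : R => f ((-1) ^+ b.1.1 * x, (-1) ^+ b.1.2 * y, z)%R) by solve_measurable.
by rewrite -(ge0_integral_sign b.2 mK).
Qed.

End reflections.

(** * Integrals of tensor products *)

Section tensor.
Context d1 d2 (T1 : measurableType d1) (T2 : measurableType d2) (R : realType).
Variable m1 : {sigma_finite_measure set T1 -> \bar R}.
Variable m2 : {sigma_finite_measure set T2 -> \bar R}.
Variables (f : T1 -> R) (g : T2 -> R).
Hypothesis fi : m1.-integrable setT (EFin \o f).
Hypothesis gi : m2.-integrable setT (EFin \o g).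

Lemma integrable_tensor :
  (m1 \x m2)%E.-integrable setT (EFin \o (fun p => f p.1 * g p.2)).
Proof.
have mf : measurable_fun setT f by move: fi => /measurable_int /measurable_EFinP.
have mg : measurable_fun setT g by move: gi => /measurable_int /measurable_EFinP.
apply/integrable12ltyP; first by rewrite /comp; solve_measurable.
rewrite /=; set C := (\int[m2]_y `|(g y)%:E|)%E.
have C0 : (0 <= C)%E by exact: integral_ge0.
have Coo : C \is a fin_num.
  by rewrite ge0_fin_numE//; move/integrableP : gi => [].
rewrite (eq_integral (fun x => `|(f x)%:E| * C)%E); last first.
  move=> x _; rewrite -ge0_integralZl//; last by solve_measurable.
  by apply: eq_integral => y _ /=; rewrite normrM EFinM.
rewrite ge0_integralZr//; last by solve_measurable.
apply: lte_mul_pinfty => //; first exact: integral_ge0.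
  by rewrite ge0_fin_numE ?integral_ge0//; move/integrableP : fi => [].
by rewrite -ge0_fin_numE.
Qed.

Lemma Rintegral_tensor :
  \int[(m1 \x m2)%E]_p (f p.1 * g p.2) = \int[m1]_x f x * \int[m2]_y g y.
Proof.
rewrite (Rintegral_fubini1 integrable_tensor)/= -RintegralZr//.
by apply: eq_Rintegral => x _; rewrite RintegralZl.
Qed.

End tensor.

Section tensor3.
Context {R : realType}.
Local Notation mu := (@lebesgue_measure R).
Variables f g k : R -> R.
Hypothesis fi : mu.-integrable setT (EFin \o f).
Hypothesis gi : mu.-integrable setT (EFin \o g).
Hypothesis ki : mu.-integrable setT (EFin \o k).
Local Notation X3 := (measurableTypeR R * measurableTypeR R * measurableTypeR R)%type.

Lemma integrable_tensor3 : (lebesgue3 R).-integrable setT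
  (EFin \o (fun s : X3 => f s.1.1 * g s.1.2 * k s.2)).
Proof.
exact: (@integrable_tensor _ _ _ _ R (lebesgue2 R) mu
  (fun p => f p.1 * g p.2) k (integrable_tensor fi gi) ki).
Qed.

Lemma Rintegral_tensor3 : \int[lebesgue3 R]_s (f s.1.1 * g s.1.2 * k s.2) =
  \int[mu]_x f x * \int[mu]_x g x * \int[mu]_x k x.
Proof.
have := @Rintegral_tensor _ _ _ _ R (lebesgue2 R) mu
  (fun p => f p.1 * g p.2) k (integrable_tensor fi gi) ki.
by move=> /= ->; rewrite (Rintegral_tensor fi gi).
Qed.

End tensor3.

(** * The tent function and the cubic B-spline *)

Section tent.
Context {R : realType}.
Local Notation mu := (@lebesgue_measure R).

Definition tent (t : R) : R := Num.max 0 (1 - `|t|).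

(** Hats are rescaled translates of a single tent, which reduces every overlap to
    one convolution. *)
Lemma hatE (a h : R) (n : nat) (x : R) : 0 < h -> (0 < n)%N ->
  hat a h n x = tent ((x - a) / h - n%:R).
Proof.
case: n => // n h0 _; rewrite /hat/=.
have [y ->] : exists y, x = a + y * h.
  by exists ((x - a) / h); field; rewrite gt_eqF.
have gridlt k : (grid a h k < a + y * h) = (k%:R < y).
  by rewrite /grid ltrD2l ltr_pM2r.
have gridle k : (grid a h k <= a + y * h) = (k%:R <= y).
  by rewrite /grid lerD2l ler_pM2r.
have ltgrid k : (a + y * h < grid a h k) = (y < k%:R).
  by rewrite /grid ltrD2l ltr_pM2r.
have legrid k : (a + y * h <= grid a h k) = (y <= k%:R).
  by rewrite /grid lerD2l ler_pM2r.
rewrite gridlt gridle legrid ltgrid.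
have -> : (a + y * h - a) / h = y by field; rewrite gt_eqF.
rewrite /grid.
have -> : (a + y * h - (a + n%:R * h)) / h = y - n%:R by field; rewrite gt_eqF.
have -> : (a + n.+2%:R * h - (a + y * h)) / h = n.+2%:R - y by field; rewrite gt_eqF.
rewrite /tent -[n.+2]addn2 -[n.+1]addn1 !natrD.
case: ifPn => [/andP[y1 y2]|y1].
  rewrite ler0_norm; last by lra.
  by rewrite max_r; lra.
case: ifPn => [/andP[y3 y2]|y3].
  rewrite ger0_norm; last by lra.
  by rewrite max_r; lra.
rewrite max_l// subr_le0 leNgt; apply/negP => /ltr_normlP[].
move: y1 y3; rewrite !negb_and -!leNgt -!ltNge => /orP y1 /orP y3 ? ?.
by case: y1; case: y3 => ? ?; lra.
Qed.

Lemma tent_ge0 t : 0 <= tent t.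
Proof. by rewrite /tent le_max lexx. Qed.

Lemma tent_le1 t : tent t <= 1.
Proof. by rewrite /tent ge_max ler01/= lerBlDr lerDl. Qed.

Lemma tent_lip s t : `|tent s - tent t| <= `|s - t|.
Proof.
have := lerB_dist s t; have := lerB_dist t s; rewrite (distrC t s) /tent.
by case: (leP 0 (1 - `|s|)) => ?; case: (leP 0 (1 - `|t|)) => ? ? ?;
  rewrite ler_norml; apply/andP; split; lra.
Qed.

Lemma tent_eq0 t : 1 <= `|t| -> tent t = 0.
Proof. by move=> t1; rewrite /tent max_l// subr_le0. Qed.

Lemma tentL t : -1 <= t <= 0 -> tent t = 1 + t.
Proof. by move=> /andP[? ?]; rewrite /tent ler0_norm// max_r; lra. Qed.

Lemma tentR t : 0 <= t <= 1 -> tent t = 1 - t.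
Proof. by move=> /andP[? ?]; rewrite /tent ger0_norm// max_r; lra. Qed.

Lemma measurable_tent : measurable_fun setT tent.
Proof.
have -> : tent = (cst 0 : R -> R) \max (fun t : R => 1 - `|t|) by [].
apply: measurable_maxr; first exact: measurable_cst.
by solve_measurable.
Qed.

(** The polynomial pieces agree at the knots, so each formula also holds on the
    closed interval. *)
Lemma B3E (v : R) :
  [/\ (v <= 0 -> B3 v = 0),
      (0 <= v <= 1 -> B3 v = v ^+ 3 / 6),
      (1 <= v <= 2 -> B3 v = - (v ^+ 3) / 2 + 2 * v ^+ 2 - 2 * v + 2 / 3),
      (2 <= v <= 3 -> B3 v = v ^+ 3 / 2 - 4 * v ^+ 2 + 10 * v - 22 / 3) &
      (3 <= v <= 4 -> B3 v = - (v - 4) ^+ 3 / 6) /\ (4 <= v -> B3 v = 0)].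
Proof.
split; last split.
all: move=> vI; rewrite /B3; case: (ltP v 0) => v0; case: (ltP v 1) => v1;
  case: (ltP v 2) => v2; case: (ltP v 3) => v3; case: (ltP v 4) => v4 /=;
  first [ by [] | (exfalso; lra) | (have E : v = 0 by lra); rewrite E; lra
    | (have E : v = 1 by lra); rewrite E; lra | (have E : v = 2 by lra); rewrite E; lra
    | (have E : v = 3 by lra); rewrite E; lra | (have E : v = 4 by lra); rewrite E; lra ].
Qed.

End tent.

Section tent_convolution.
Context {R : realType}.
Local Notation mu := (@lebesgue_measure R).

Lemma B3_sym (u : R) : B3 (- u + 2) = B3 (u + 2).
Proof.
wlog u0 : u / 0 <= u.
  move=> H; have [/H//|u0] := leP 0 u.
  by have := H (- u); rewrite opprK => <-//; rewrite oppr_ge0 ltW.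
have [bl0 bl1 bl2 _ _] := B3E (- u + 2).
have [_ _ _ br1 [br2 br3]] := B3E (u + 2).
have [u1|u1] := leP u 1; first by rewrite bl2 ?br1; [field|lra|lra].
have [u2|u2] := leP u 2; first by rewrite bl1 ?br2; [field|lra|lra].
by rewrite bl0 ?br3//; lra.
Qed.

Lemma B3_out (u : R) : 2 <= `|u| -> B3 (u + 2) = 0.
Proof.
have [u0|u0] := leP 0 u; rewrite ?(ger0_norm u0) ?(ltr0_norm u0) => u2.
  by have [_ _ _ _ [_ H]] := B3E (u + 2); apply: H; lra.
by have [H _ _ _ _] := B3E (u + 2); apply: H; lra.
Qed.

Local Open Scope ereal_scope.

Lemma integral_quadratic (a b c0 c1 c2 : R) : (a <= b)%R ->
  \int[mu]_(t in `[a, b]) (c0 + c1 * t + c2 * t ^+ 2)%:E =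
  (c0 * (b - a) + c1 * (b ^+ 2 - a ^+ 2) / 2 + c2 * (b ^+ 3 - a ^+ 3) / 3)%:E.
Proof.
rewrite le_eqVlt => /predU1P[->|ab].
  by rewrite set_itv1 integral_set1 !subrr !mulr0 !mul0r !addr0.
pose P : {poly R} := (c0%:P + c1 *: 'X + c2 *: 'X^2)%R.
pose Q : {poly R} := (c0 *: 'X + (c1 / 2) *: 'X^2 + (c2 / 3) *: 'X^3)%R.
have QP : (Q^`() = P)%R.
  rewrite /Q !derivD !derivZ derivX !derivXn /= alg_polyC expr1 /P.
  by rewrite -[('X *+ 2)%R]scaler_nat -[('X^2 *+ 3)%R]scaler_nat !scalerA !divfK ?pnatr_eq0.
rewrite (@eq_integral _ _ _ mu _ (fun t => (horner P t)%:E)); last first.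
  by move=> t _; rewrite /P !(hornerD, hornerZ, hornerX, hornerXn, hornerC).
rewrite (@continuous_FTC2 _ _ (horner Q))//.
- by rewrite -EFinB /Q !(hornerD, hornerZ, hornerX, hornerXn); congr EFin; field.
- by apply: (@continuous_subspaceT _ _ _ (horner P)); exact: continuous_horner.
- split.
  + by move=> x _; exact: derivable_horner.
  + by apply: cvg_at_right_filter; exact: continuous_horner.
  + by apply: cvg_at_left_filter; exact: continuous_horner.
- by move=> x _; rewrite -derivE QP.
Qed.

Lemma ge0_integral_itv_split (f : R -> \bar R) (a b c : R) :
  (a <= b)%R -> (b <= c)%R ->
  measurable_fun setT f -> (forall x, 0 <= f x) ->
  \int[mu]_(t in `[a, c]) f t =
  \int[mu]_(t in `[a, b]) f t + \int[mu]_(t in `[b, c]) f t.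
Proof.
move=> ab bc mf f0.
rewrite (@itv_bndbnd_setU _ _ _ (BRight b)) ?bnd_simp// ge0_integral_setU//=.
- by rewrite integral_itv_obnd_cbnd//; exact: measurable_funTS.
- exact: measurable_funTS.
- rewrite disj_set2E; apply/eqP/seteqP; split => x //=.
  by rewrite !in_itv/= => -[/andP[_ xb] /andP[bx _]]; move: (lt_le_trans bx xb); rewrite ltxx.
Qed.

(** The cubic B-spline is the convolution of the tent with itself.  By symmetry
    take 0 <= u; the product then lives on [-1, 1 - u], where it is a single
    quadratic polynomial if 1 <= u and changes form at -u and 0 otherwise. *)
Lemma integral_tent_tent (u : R) :
  \int[mu]_t (tent t * tent (t + u))%:E = (B3 (u + 2))%:E.
Proof.
have mt := @measurable_tent R.
wlog u0 : u / (0 <= u)%R.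
  move=> H; have [/H//|u0] := leP 0%R u.
  rewrite -B3_sym -H; last by rewrite oppr_ge0 ltW.
  rewrite -(@ge0_integral_shift _ (fun t => (tent t * tent (t - u))%:E) u).
  - by apply: eq_integral => t _; rewrite addrK mulrC.
  - by solve_measurable.
  - by move=> t; rewrite lee_fin mulr_ge0 ?tent_ge0.
pose f t := (tent t * tent (t + u))%:E.
have mf : measurable_fun setT f by rewrite /f; solve_measurable.
have f0 t : 0 <= f t by rewrite lee_fin mulr_ge0 ?tent_ge0.
have foff t : (t < -1)%R || (1 - u < t)%R -> f t = 0.
  move=> /orP[] ?; rewrite /f; first by rewrite tent_eq0 ?mul0r// ler0_norm; lra.
  by rewrite [tent (t + u)]tent_eq0 ?mulr0// ger0_norm; lra.
have fI : \int[mu]_t f t = \int[mu]_(t in `[(-1)%R, (1 - u)%R]) f t.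
  rewrite [RHS]integral_mkcond; apply: eq_integral => t _; rewrite /patch.
  case: ifPn => //; rewrite mem_setE in_itv/= negb_and -!ltNge.
  exact: foff.
rewrite -[LHS]/(\int[mu]_t f t) fI.
have [u2|u2] := ltP 2%R u.
  rewrite set_itv_ge ?integral_set0 ?bnd_simp -?ltNge; last by lra.
  by rewrite B3_out// ger0_norm// ltW.
have [_ _ _ b1 [b2 _]] := B3E (u + 2).
have [u1|u1] := leP 1%R u.
  rewrite (@eq_integral _ _ _ mu _ (fun t => ((1 - u) + (- u) * t + (-1) * t ^+ 2)%:E)); last first.
    move=> t; rewrite mem_setE in_itv/= => /andP[? ?].
    by rewrite /f tentL ?tentR; [congr EFin; ring|lra|lra].
  rewrite integral_quadratic; last by lra.
  by rewrite b2; [congr EFin; field|lra].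
rewrite (@ge0_integral_itv_split f (-1) (- u) (1 - u))//; [|lra|lra].
rewrite (@ge0_integral_itv_split f (- u) 0 (1 - u))//; [|lra|lra].
rewrite (@eq_integral _ _ _ mu _ (fun t => ((1 + u) + (2 + u) * t + 1 * t ^+ 2)%:E)); last first.
  move=> t; rewrite mem_setE in_itv/= => /andP[? ?].
  by rewrite /f tentL ?tentL; [congr EFin; ring|lra|lra].
rewrite [X in _ + (X + _)](@eq_integral _ _ _ mu _ (fun t => ((1 - u) + (- u) * t + (-1) * t ^+ 2)%:E)); last first.
  move=> t; rewrite mem_setE in_itv/= => /andP[? ?].
  by rewrite /f tentL ?tentR; [congr EFin; ring|lra|lra].
rewrite [X in _ + (_ + X)](@eq_integral _ _ _ mu _ (fun t => ((1 - u) + (u - 2) * t + 1 * t ^+ 2)%:E)); last first.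
  move=> t; rewrite mem_setE in_itv/= => /andP[? ?].
  by rewrite /f tentR ?tentR; [congr EFin; ring|lra|lra].
rewrite !integral_quadratic; [|lra|lra|lra].
by rewrite b1 -?EFinD; [congr EFin; field|lra].
Qed.

End tent_convolution.

(** * Overlaps of translated basis functions *)

Section hat_overlaps.
Context {R : realType}.
Local Notation mu := (@lebesgue_measure R).
Local Notation X3 := (measurableTypeR R * measurableTypeR R * measurableTypeR R)%type.

Lemma integral_hat_hat (a h : R) (n m : nat) (alpha beta : R) :
  0 < h -> (0 < n)%N -> (0 < m)%N ->
  (\int[mu]_x (hat a h n (x + alpha) * hat a h m (x + beta))%:E =
  (h * B3 ((beta - alpha) / h + (n%:R - m%:R) + 2))%:E)%E.
Proof.
move=> h0 n0 m0; have mt := @measurable_tent R.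
set u := (beta - alpha) / h + (n%:R - m%:R).
pose c := (alpha - a) / h - n%:R.
pose g t := (tent t * tent (t + u))%:E.
have mg : measurable_fun setT g by rewrite /g; solve_measurable.
have g0 t : (0 <= g t)%E by rewrite lee_fin mulr_ge0 ?tent_ge0.
have mgc : measurable_fun setT (fun t : R => g (t + c)) by solve_measurable.
have hi0 : 0 < h^-1 by rewrite invr_gt0.
rewrite -[u + 2]addr0 EFinM addr0 -integral_tent_tent -[X in (_ * X)%E]/(\int[mu]_t g t)%E.
rewrite -(ge0_integral_shift c mg g0) -(ge0_integral_scale hi0 mgc (fun t => g0 _)).
rewrite muleA -EFinM divff ?gt_eqF// mul1e.
apply: eq_integral => x _; rewrite !hatE// /g /c /u; congr ((tent _ * tent _)%:E);
  by field; rewrite gt_eqF.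
Qed.

Lemma hat_ge0 (a h x : R) n : 0 < h -> (0 < n)%N -> 0 <= hat a h n x.
Proof. by move=> h0 n0; rewrite hatE// tent_ge0. Qed.

Lemma hat_le1 (a h x : R) n : 0 < h -> (0 < n)%N -> hat a h n x <= 1.
Proof. by move=> h0 n0; rewrite hatE// tent_le1. Qed.

Lemma hat_lip (a h x y : R) n : 0 < h -> (0 < n)%N ->
  `|hat a h n x - hat a h n y| <= `|x - y| / h.
Proof.
move=> h0 n0; rewrite !hatE//; apply: le_trans (tent_lip _ _) _.
rewrite (_ : `|x - y| / h = `|(x - y) / h|); last first.
  by rewrite normrM normfV (gtr0_norm h0).
rewrite le_eqVlt; apply/orP; left; apply/eqP.
by congr `|_|; field; rewrite gt_eqF.
Qed.

Lemma measurable_hat (a h : R) n : 0 < h -> (0 < n)%N ->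
  measurable_fun setT (hat a h n).
Proof.
move=> h0 n0; have mt := @measurable_tent R.
rewrite (_ : hat a h n = fun x => tent ((x - a) / h - n%:R)); first by solve_measurable.
by apply/funext => x; rewrite hatE.
Qed.

Lemma integrable_hat_hat (a h : R) (n m : nat) (alpha beta : R) :
  0 < h -> (0 < n)%N -> (0 < m)%N ->
  mu.-integrable setT
    (EFin \o (fun x => hat a h n (x + alpha) * hat a h m (x + beta))).
Proof.
move=> h0 n0 m0.
have mn := measurable_hat a h0 n0; have mm := measurable_hat a h0 m0.
apply/integrableP; split; first by rewrite /comp; solve_measurable.
under eq_integral do rewrite /= ger0_norm ?mulr_ge0 ?hat_ge0//.
by rewrite integral_hat_hat// ltry.
Qed.

Lemma Rintegral_hat_hat (a h : R) (n m : nat) (alpha beta : R) :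
  0 < h -> (0 < n)%N -> (0 < m)%N ->
  \int[mu]_x (hat a h n (x + alpha) * hat a h m (x + beta)) =
  h * B3 ((beta - alpha) / h + (n%:R - m%:R) + 2).
Proof. by move=> h0 n0 m0; rewrite /Rintegral integral_hat_hat. Qed.

Section hat3.
Variables (a : R * R * R) (h : R) (n1 n2 n3 m1 m2 m3 : nat).
Hypotheses (h0 : 0 < h) (n10 : (0 < n1)%N) (n20 : (0 < n2)%N) (n30 : (0 < n3)%N)
  (m10 : (0 < m1)%N) (m20 : (0 < m2)%N) (m30 : (0 < m3)%N).
Let u := hat3 a h n1 n2 n3.
Let v := hat3 a h m1 m2 m3.

(** Up to the factor h^3, the integral of a basis function times the translate by
    [- w] of another one, [d] being the difference of their indices. *)
Definition overlap (d w : R * R * R) : R :=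
  B3 (w.1.1 / h + d.1.1 + 2) * B3 (w.1.2 / h + d.1.2 + 2) * B3 (w.2 / h + d.2 + 2).

Let d : R * R * R := (n1%:R - m1%:R, n2%:R - m2%:R, n3%:R - m3%:R).

(** The integrand is a tensor product, so only one-dimensional overlaps have to be
    computed. *)
Lemma hat3_overlap (s t : R * R * R) :
  (lebesgue3 R).-integrable setT
    (EFin \o (fun x : X3 => u (x + s) * v (x + t))) /\
  \int[lebesgue3 R]_x (u (x + s) * v (x + t)) = h ^+ 3 * overlap d (t - s).
Proof.
have i1 := integrable_hat_hat a.1.1 s.1.1 t.1.1 h0 n10 m10.
have i2 := integrable_hat_hat a.1.2 s.1.2 t.1.2 h0 n20 m20.
have i3 := integrable_hat_hat a.2 s.2 t.2 h0 n30 m30.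
have uvE : (fun x : R * R * R => u (x + s) * v (x + t)) = fun x =>
  (hat a.1.1 h n1 (x.1.1 + s.1.1) * hat a.1.1 h m1 (x.1.1 + t.1.1)) *
  (hat a.1.2 h n2 (x.1.2 + s.1.2) * hat a.1.2 h m2 (x.1.2 + t.1.2)) *
  (hat a.2 h n3 (x.2 + s.2) * hat a.2 h m3 (x.2 + t.2)).
  by apply/funext => x; rewrite /u /v /hat3/=; ring.
split.
  have := integrable_tensor3 i1 i2 i3.
  by rewrite -uvE.
rewrite (_ : \int[lebesgue3 R]_x (u (x + s) * v (x + t)) = \int[lebesgue3 R]_x
  ((hat a.1.1 h n1 (x.1.1 + s.1.1) * hat a.1.1 h m1 (x.1.1 + t.1.1)) *
  (hat a.1.2 h n2 (x.1.2 + s.1.2) * hat a.1.2 h m2 (x.1.2 + t.1.2)) *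
  (hat a.2 h n3 (x.2 + s.2) * hat a.2 h m3 (x.2 + t.2)))); last by rewrite uvE.
rewrite (Rintegral_tensor3 i1 i2 i3) !Rintegral_hat_hat// /overlap/=; ring.
Qed.

Lemma integrable_increments (s : R * R * R) :
  (lebesgue3 R).-integrable setT
    (EFin \o (fun x : X3 => (u (x + s) - u x) * (v (x + s) - v x))).
Proof.
have [iss _] := hat3_overlap s s.
have [i00 _] := hat3_overlap 0 0.
have [i0s _] := hat3_overlap 0 s.
have [is0 _] := hat3_overlap s 0.
have := integrableB measurableT (integrableD measurableT iss i00)
  (integrableD measurableT is0 i0s).
apply: eq_integrable => // x _ /=; rewrite -!EFinD; congr EFin.
by rewrite !addr0; ring.
Qed.

Lemma Rintegral_increments (s : R * R * R) :
  \int[lebesgue3 R]_x ((u (x + s) - u x) * (v (x + s) - v x)) =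
  h ^+ 3 * (2 * overlap d 0 - overlap d (- s) - overlap d s).
Proof.
have [iss Iss] := hat3_overlap s s.
have [i00 I00] := hat3_overlap 0 0.
have [i0s I0s] := hat3_overlap 0 s.
have [is0 Is0] := hat3_overlap s 0.
rewrite (_ : \int[lebesgue3 R]_x _ = \int[lebesgue3 R]_x
  (((u (x + s) * v (x + s)) + (u (x + 0) * v (x + 0))) -
   ((u (x + s) * v (x + 0)) + (u (x + 0) * v (x + s))))); last first.
  by apply: eq_Rintegral => x _; rewrite !addr0; ring.
rewrite RintegralB//; last 2 first.
- exact: (integrableD _ iss i00).
- exact: (integrableD _ is0 i0s).
rewrite !RintegralD// Iss I00 I0s Is0 !subrr sub0r subr0; ring.
Qed.

End hat3.
End hat_overlaps.

(** * The bilinear form as an integral over increments *)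

Section bilinear_form_reduction.
Context {R : realType}.
Local Notation mu := (@lebesgue_measure R).
Local Notation X3 := (measurableTypeR R * measurableTypeR R * measurableTypeR R)%type.

Lemma norm3_ge0 (s : R * R * R) : 0 <= norm3 s.
Proof. exact: sqrtr_ge0. Qed.

Let sumsq_ge0 (s : R * R * R) : 0 <= s.1.1 ^+ 2 + s.1.2 ^+ 2 + s.2 ^+ 2.
Proof. by rewrite !addr_ge0 ?sqr_ge0. Qed.

Lemma norm3_eq0 (s : R * R * R) : norm3 s = 0 -> s = 0.
Proof.
move=> /eqP; rewrite sqrtr_eq0 => s0.
have {s0}/eqP : s.1.1 ^+ 2 + s.1.2 ^+ 2 + s.2 ^+ 2 = 0.
  by apply/eqP; rewrite eq_le s0 sumsq_ge0.
rewrite !paddr_eq0 ?addr_ge0 ?sqr_ge0// !sqrf_eq0.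
by case: s => [[x y] z] /= /andP[/andP[/eqP-> /eqP->] /eqP->].
Qed.

Lemma coord_le_norm3 (s : R * R * R) :
  [/\ `|s.1.1| <= norm3 s, `|s.1.2| <= norm3 s & `|s.2| <= norm3 s].
Proof.
have := sumsq_ge0 s; rewrite /norm3 => s0.
have h1 := sqr_ge0 s.1.1; have h2 := sqr_ge0 s.1.2; have h3 := sqr_ge0 s.2.
by split; rewrite -sqrtr_sqr ler_wsqrtr//; lra.
Qed.

Lemma itv_enlarge (p q x e : R) : 0 < e -> p < x < q -> p - e < x < q + e.
Proof. by move=> e0 /andP[px xq]; apply/andP; split; lra. Qed.

Lemma itv_shrink (p q x y n e : R) :
  `|y| <= n -> n < e -> p < x + y < q -> p - e < x < q + e.
Proof.
move=> yn ne /andP[? ?]; have /ltr_normlP[? ?] := le_lt_trans yn ne.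
by apply/andP; split; lra.
Qed.

Lemma measurable_norm3 : measurable_fun setT (fun s : X3 => norm3 s).
Proof.
rewrite (_ : (fun s : X3 => norm3 s) = fun s : X3 =>
  Num.sqrt ((s.1.1 : R) ^+ 2 + (s.1.2 : R) ^+ 2 + (s.2 : R) ^+ 2))//.
by solve_measurable.
Qed.

Lemma measurable_add3 : measurable_fun setT (fun p : X3 * X3 => (p.1 + p.2 : R * R * R) : X3).
Proof.
rewrite (_ : (fun p => _) = fun p : X3 * X3 =>
  ((p.1.1.1 : R) + p.2.1.1, (p.1.1.2 : R) + p.2.1.2, (p.1.2 : R) + p.2.2)) //.
by solve_measurable.
Qed.

(** On the interval, the superlevel sets of a nonincreasing function are
    intervals. *)
Lemma nonincreasing_in_measurable (rho : R -> R) (delta : R) :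
  (forall r s : R, 0 < r -> r <= s -> s < delta -> rho s <= rho r) ->
  measurable_fun `]0, delta[%classic rho.
Proof.
move=> ni; apply: (measurability (@RGenCInfty.G R)) => [|/= _ [_] [c] -> <-].
  exact: RGenCInfty.measurableE.
apply: is_interval_measurable => r s /=.
rewrite !in_itv/= !andbT => -[/andP[r0 rd] cr] [/andP[s0 sd] cs] t /andP[rt ts].
have td := le_lt_trans ts sd; have t0 := lt_le_trans r0 rt.
by rewrite !in_itv/= andbT t0 td; split => //; apply: (le_trans cs); exact: ni.
Qed.

Section reduction.
Variables (a b : R * R * R) (delta : R) (rho : R -> R).
Hypothesis delta_gt0 : 0 < delta.
Hypothesis rho_nonincreasing :
  forall r s : R, 0 < r -> r <= s -> s < delta -> rho s <= rho r.
Hypothesis rho_normalized :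
  \int[lebesgue3 R]_(s in ball3 delta) (rho (norm3 s) * norm3 s ^+ 2) = 3.

(** The profile is unconstrained at 0, where it may be singular, and beyond
    [delta].  Extending it by 0 there makes it measurable on the line and builds the
    ball into the integrand; the value at 0 is harmless since all integrands vanish
    to second order there. *)
Definition cutoff (r : R) : R := (rho \_ `]0, delta[) r.

Lemma measurable_cutoff : measurable_fun setT cutoff.
Proof.
apply/(measurable_restrictT _ _).1 => //.
exact: nonincreasing_in_measurable.
Qed.

Lemma cutoff_in r : 0 < r < delta -> cutoff r = rho r.
Proof. by move=> rd; rewrite /cutoff patchE mem_setE in_itv/= rd. Qed.

Lemma cutoff_out r : delta <= r -> cutoff r = 0.
Proof. by move=> rd; rewrite /cutoff patchE mem_setE in_itv/= (ltNge r delta) rd andbF. Qed.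

(** A measurable function whose integral is infinite or undefined has
    real-valued integral 0, so the normalization to 3 forces integrability. *)
Lemma integrable_cutoff : (lebesgue3 R).-integrable setT
  (EFin \o (fun s : X3 => cutoff (norm3 s) * norm3 s ^+ 2)).
Proof.
have mc := measurable_cutoff; have mn := measurable_norm3.
have mf : measurable_fun setT (fun s : X3 => cutoff (norm3 s) * norm3 s ^+ 2).
  by solve_measurable.
apply/integrableP; split; first exact/measurable_EFinP.
rewrite integral_fin_num_abs//.
move: rho_normalized; rewrite Rintegral_mkcond /Rintegral.
rewrite (eq_integral (fun s : X3 => (cutoff (norm3 s) * norm3 s ^+ 2)%:E)); last first.
  move=> s _; rewrite patchE; case: ifPn => [|]; rewrite /ball3.
    rewrite inE/= => sd; have := norm3_ge0 s; rewrite le_eqVlt => /predU1P[<-|s0].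
      by rewrite !expr0n !mulr0.
    by rewrite cutoff_in// s0.
  rewrite notin_setE/= => /negP; rewrite -leNgt => sd.
  by rewrite cutoff_out// mul0r.
by case: (\int[_]_x _)%E => //= /eqP; rewrite eq_sym pnatr_eq0.
Qed.

Lemma integrable_indic_box : (lebesgue3 R).-integrable setT
  (EFin \o (fun x : X3 => \1_(enlarged_box3 a b delta) x : R)).
Proof.
have := integrable_tensor3
  (integrable_indic_itv (a.1.1 - delta) (b.1.1 + delta) false true)
  (integrable_indic_itv (a.1.2 - delta) (b.1.2 + delta) false true)
  (integrable_indic_itv (a.2 - delta) (b.2 + delta) false true).
apply: eq_integrable => // x _ /=; congr EFin.
rewrite !indicE !mem_setE !in_itv/=.
rewrite (_ : (x \in enlarged_box3 a b delta) =
  (a.1.1 - delta < x.1.1 < b.1.1 + delta) &&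
  (a.1.2 - delta < x.1.2 < b.1.2 + delta) &&
  (a.2 - delta < x.2 < b.2 + delta)); first by rewrite -!mulnb !natrM.
apply/idP/idP; first by rewrite inE => -[? ? ?]; do 2 (apply/andP; split => //).
by move=> /andP[/andP[? ?] ?]; rewrite inE; split.
Qed.

Variables (u v : R * R * R -> R) (L : R).
Hypotheses (mu_ : measurable_fun setT (u : X3 -> R))
  (mv_ : measurable_fun setT (v : X3 -> R)).
Hypothesis L0 : 0 <= L.
Hypothesis ulip : forall x s, `|u (x + s) - u x| <= L * norm3 s.
Hypothesis vlip : forall x s, `|v (x + s) - v x| <= L * norm3 s.
Hypothesis uout : forall x, ~ box3 a b x -> u x = 0.

Let D (x s : R * R * R) := (u (x + s) - u x) * (v (x + s) - v x).
Hypothesis Di : forall s, (lebesgue3 R).-integrable setT (EFin \o (fun x : X3 => D x s)).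

Let Dout x s : ~ enlarged_box3 a b delta x -> norm3 s < delta -> D x s = 0.
Proof.
move=> xO sd; have [s1 s2 s3] := coord_le_norm3 s.
have ux : u x = 0.
  by apply: uout => -[? ? ?]; apply: xO; split; apply: itv_enlarge.
have uxs : u (x + s) = 0.
  apply: uout => -[x1 x2 x3]; apply: xO.
  split; [apply: itv_shrink s1 sd x1|apply: itv_shrink s2 sd x2|
    apply: itv_shrink s3 sd x3].
by rewrite /D ux uxs subrr mul0r.
Qed.

Let F (p : X3 * X3) : R := D p.1 p.2 * cutoff (norm3 p.2).

Let Fi : (sf_lebesgue3 R \x sf_lebesgue3 R)%E.-integrable setT (EFin \o F).
Proof.
have := @integrable_tensor _ _ _ _ R (sf_lebesgue3 R) (sf_lebesgue3 R) _ _
  integrable_indic_box integrable_cutoff.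
move=> /(integrableZl measurableT (L ^+ 2)).
apply: le_integrable => //.
  have mc := measurable_cutoff; have mn := measurable_norm3.
  have ma := measurable_add3.
  have mua : measurable_fun setT (fun p : X3 * X3 => u (p.1 + p.2)).
    exact: (measurableT_comp mu_ ma).
  have mva : measurable_fun setT (fun p : X3 * X3 => v (p.1 + p.2)).
    exact: (measurableT_comp mv_ ma).
  have mu1 : measurable_fun setT (fun p : X3 * X3 => u p.1).
    exact: (measurableT_comp mu_ measurable_fst).
  have mv1 : measurable_fun setT (fun p : X3 * X3 => v p.1).
    exact: (measurableT_comp mv_ measurable_fst).
  have mcn : measurable_fun setT (fun p : X3 * X3 => cutoff (norm3 p.2)).
    by solve_measurable.
  apply/measurable_EFinP; apply: (measurable_funM _ mcn).
  by apply: measurable_funM; apply: measurable_funB.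
move=> [x s] _ /=; rewrite lee_fin /F/=.
have [sd|sd] := ltP (norm3 s) delta; last by rewrite cutoff_out// !(mul0r, mulr0) normr0.
have [xO|xO] := pselect (enlarged_box3 a b delta x); last first.
  by rewrite Dout// mul0r normr0.
rewrite indicE mem_set// mul1r !normrM.
rewrite (ger0_norm L0).
have nn := norm3_ge0 s; rewrite (ger0_norm nn).
rewrite [leRHS](_ : _ = (L * norm3 s) * (L * norm3 s) * `|cutoff (norm3 s)|); last by ring.
by apply: ler_pM => //; apply: ler_pM.
Qed.

(** The integrand is dominated by L^2 |s|^2 |rho(|s|)| times the indicator of the
    enlarged box, a tensor product of integrable functions; if |s| < delta, both
    [u x] and [u (x + s)] vanish for [x] outside the enlarged box. *)
Lemma bilinear_form_swap :
  (lebesgue3 R).-integrable setT (EFin \o (fun s : X3 =>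
    \int[lebesgue3 R]_x D x s * cutoff (norm3 s))) /\
  bilinear_form a b delta rho u v =
  2^-1 * \int[lebesgue3 R]_s (\int[lebesgue3 R]_x D x s * cutoff (norm3 s)).
Proof.
have inE' s : \int[lebesgue3 R]_x F (x, s) = \int[lebesgue3 R]_x D x s * cutoff (norm3 s).
  exact: (RintegralZr (cutoff (norm3 s)) measurableT (Di s)).
split.
  have := integrable_Rintegral2 Fi.
  by apply: eq_integrable => // s _ /=; rewrite -inE'.
rewrite /bilinear_form; congr (_ * _).
rewrite Rintegral_mkcond.
transitivity (\int[sf_lebesgue3 R]_x \int[sf_lebesgue3 R]_s F (x, s)).
  apply: eq_Rintegral => x _; rewrite patchE.
  case: ifPn => [_|]; last first.
    rewrite notin_setE => xO; apply/esym.
    rewrite /Rintegral integral0_eq// => s _; rewrite /F/=.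
    have [sd|sd] := ltP (norm3 s) delta; last by rewrite cutoff_out// mulr0.
    by rewrite Dout// mul0r.
  rewrite Rintegral_mkcond; apply: eq_Rintegral => s _.
  rewrite patchE; case: ifPn.
    rewrite inE /ball3/= => sd; have := norm3_ge0 s; rewrite le_eqVlt => /predU1P[/esym s0|s0].
      by rewrite /F /D /= (norm3_eq0 s0) addr0 subrr !mul0r.
    by rewrite /F/= cutoff_in// s0.
  rewrite notin_setE /ball3/= => /negP; rewrite -leNgt => sd.
  by rewrite /F/= cutoff_out// mulr0.
rewrite -(Rintegral_fubini1 Fi) (Rintegral_fubini2 Fi).
by apply: eq_Rintegral => s _; rewrite -inE'.
Qed.

End reduction.
End bilinear_form_reduction.

(** * The increment kernel *)

Section increment_kernel_facts.
Context {R : realType}.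
Local Notation mu := (@lebesgue_measure R).
Local Notation X3 := (measurableTypeR R * measurableTypeR R * measurableTypeR R)%type.

Lemma Rintegral_lebesgue3 (g : X3 -> R) :
  (lebesgue3 R).-integrable setT (EFin \o g) ->
  mu.-integrable setT (EFin \o (fun x => \int[mu]_y \int[mu]_z g (x, y, z))) /\
  \int[lebesgue3 R]_p g p = \int[mu]_x \int[mu]_y \int[mu]_z g (x, y, z).
Proof.
move=> gi.
have gi1 := @integrable_Rintegral1 _ _ _ _ R (lebesgue2 R) mu _ gi.
split; first exact: (integrable_Rintegral1 gi1).
transitivity (\int[lebesgue2 R]_p \int[mu]_z g (p, z)).
  exact: (@Rintegral_fubini1 _ _ _ _ R (lebesgue2 R) mu _ gi).
exact: (Rintegral_fubini1 gi1).
Qed.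

Lemma measurable_B3 : measurable_fun setT (@B3 R).
Proof.
have mI (p q : R) : measurable_fun setT (fun t : R => p <= t < q).
  by apply: measurable_and; [exact: measurable_fun_ler|exact: measurable_fun_ltr].
rewrite /B3; do 4 (apply: measurable_fun_ifT; [exact: mI|by solve_measurable|]).
exact: measurable_cst.
Qed.

(** The B-spline is the integral of a product with values in [0, 1] that
    is supported in an interval of length 2. *)
Lemma B3_norm_le2 (v : R) : `|B3 v| <= 2.
Proof.
have mt := @measurable_tent R.
have := integral_tent_tent (v - 2); rewrite subrK => BE.
have B0 : 0 <= B3 v.
  rewrite -lee_fin -BE; apply: integral_ge0 => t _.
  by rewrite lee_fin mulr_ge0 ?tent_ge0.
rewrite ger0_norm// -lee_fin -BE.
have -> : 2%:E = (\int[mu]_(t in `[(-1)%R, 1%R]) (cst 1%:E t))%E :> \bar R.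
  rewrite integral_cst//= lebesgue_measure_itv/= lte_fin mul1e ifT; last by lra.
  by rewrite -EFinB; congr EFin; ring.
rewrite [leRHS]integral_mkcond; apply: ge0_le_integral => //.
- by move=> t _; rewrite lee_fin mulr_ge0 ?tent_ge0.
- by solve_measurable.
- by apply/(measurable_restrictT _ _).1 => //.
- move=> t _; rewrite patchE; case: ifPn => [_|].
    by rewrite lee_fin -[leRHS]mulr1 ler_pM ?tent_ge0 ?tent_le1.
  rewrite mem_setE in_itv/= negb_and -!ltNge => tI.
  rewrite tent_eq0 ?mul0r//; case/orP: tI => ?.
    by rewrite ler0_norm; lra.
  by rewrite ger0_norm; lra.
Qed.

(** The integral over x of the product of the increments by [s] of two basis
    functions, divided by h^3. *)
Definition increment_kernel (h : R) (d s : R * R * R) : R :=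
  2 * overlap h d 0 - overlap h d (- s) - overlap h d s.

Lemma measurable_increment_kernel h d :
  measurable_fun setT (fun s : X3 => increment_kernel h d s).
Proof.
have mB := measurable_B3.
rewrite (_ : (fun s : X3 => _) = fun s : X3 =>
  2 * overlap h d 0 -
  B3 (- (s.1.1 : R) / h + d.1.1 + 2) * B3 (- (s.1.2 : R) / h + d.1.2 + 2) *
    B3 (- (s.2 : R) / h + d.2 + 2) -
  B3 ((s.1.1 : R) / h + d.1.1 + 2) * B3 ((s.1.2 : R) / h + d.1.2 + 2) *
    B3 ((s.2 : R) / h + d.2 + 2)) //.
by solve_measurable.
Qed.

Lemma increment_kernel_bounded h d s : `|increment_kernel h d s| <= 32.
Proof.
have ob w : `|overlap h d w| <= 8.
  rewrite /overlap !normrM (_ : 8 = 2 * 2 * 2); last by ring.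
  by do 2 (apply: ler_pM; rewrite ?mulr_ge0 ?B3_norm_le2//).
rewrite /increment_kernel.
have /ler_normlP[? ?] := ob 0; have /ler_normlP[? ?] := ob s.
have /ler_normlP[? ?] := ob (- s).
by rewrite ler_norml; apply/andP; split; lra.
Qed.

Lemma overlap_reflect h (b : bool * bool * bool) (d w : R * R * R) :
  overlap h (reflect3 b d) (reflect3 b w) = overlap h d w.
Proof.
have B3s (c : bool) (x y : R) :
    B3 ((-1) ^+ c * x / h + (-1) ^+ c * y + 2) = B3 (x / h + y + 2).
  case: c; last by rewrite !mul1r.
  by rewrite !mulN1r mulNr -opprD B3_sym.
by rewrite /overlap /reflect3 /= !B3s.
Qed.

(** By the symmetry of the B-spline, flipping the sign of an index difference
    amounts to flipping the corresponding coordinate of the increment. *)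
Lemma increment_kernel_reflect h b d s :
  increment_kernel h (reflect3 b d) (reflect3 b s) = increment_kernel h d s.
Proof.
rewrite /increment_kernel overlap_reflect.
rewrite (_ : - reflect3 b s = reflect3 b (- s)); last first.
  by rewrite /reflect3 /= !mulrN.
rewrite overlap_reflect -{1}(overlap_reflect h b d 0).
by congr (2 * overlap _ _ _ - _ - _); rewrite /reflect3 /= !mulr0.
Qed.

Lemma norm3_reflect b (s : R * R * R) : norm3 (reflect3 b s) = norm3 s.
Proof.
rewrite /norm3 /reflect3 /= !exprMn -!exprM ![(_ * 2)%N]mulnC !exprM sqrrN.
by rewrite !expr1n !mul1r.
Qed.

Lemma norm3_spherical (p : R * R * R) : 0 <= p.1.1 -> norm3 (spherical p) = p.1.1.
Proof.
move=> r0; rewrite /norm3 /spherical/= -[RHS]ger0_norm// -sqrtr_sqr; congr Num.sqrt.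
rewrite !exprMn -mulrDr cos2Dsin2 mulr1 -mulrDr [X in _ * X]addrC cos2Dsin2 mulr1 //.
Qed.

End increment_kernel_facts.

(** * Splitting the kernel integral into radius and angles *)

Section radial_angular_split.
Context {R : realType}.
Local Notation mu := (@lebesgue_measure R).
Local Notation X3 := (measurableTypeR R * measurableTypeR R * measurableTypeR R)%type.
Local Notation Ipi := ([set` `]0, pi[%R] : set R).
Local Notation I2pi := ([set` `]0, (2 * pi)[%R] : set R).
Local Notation Ipos := ([set` `]0, +oo[%R] : set R).

Variables (k : X3 -> R) (M : R) (w : R -> R).
Hypothesis mk : measurable_fun setT k.
Hypothesis kM : forall s, `|k s| <= M.

(** The integral of [k] over the sphere of radius [r], divided by r^2. *)
Definition angular_integral (r : R) : R :=
  \int[mu]_(t in `[0, pi]) \int[mu]_(f in `[0, (2 * pi)%R])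
    (k (spherical (r, t, f)) * sin t).

Let q (r : R) (p : R * R) : R :=
  \1_Ipi p.1 * \1_I2pi p.2 * (k (spherical (r, p.1, p.2)) * sin p.1).

Let mks r t : measurable_fun setT (fun f : R => k (spherical (r, t, f)) * sin t).
Proof. by rewrite /spherical/=; solve_measurable. Qed.

Let qi r : (lebesgue2 R).-integrable setT (EFin \o q r).
Proof.
have := @integrable_tensor _ _ _ _ R mu mu _ _
  (integrable_indic_itv 0 pi false true)
  (integrable_indic_itv 0 (2 * pi) false true).
move=> /(integrableZl measurableT M).
apply: le_integrable => //.
  by rewrite /comp /q /spherical/=; solve_measurable.
move=> p _ /=; rewrite lee_fin /q !normrM.
rewrite [leRHS](_ : _ = `|\1_Ipi p.1| * `|\1_I2pi p.2| * `|M|); last by ring.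
apply: ler_wpM2l; first exact: mulr_ge0.
rewrite -[leRHS]mulr1; apply: ler_pM => //.
  by rewrite (le_trans (kM _))// ler_norm.
by rewrite ler_norml sin_geN1 sin_le1.
Qed.

Let qE r : \int[mu]_t \int[mu]_f q r (t, f) = angular_integral r.
Proof.
rewrite /angular_integral [RHS]Rintegral_mkcond; apply: eq_Rintegral => t _.
rewrite patchE mem_setE in_itv/=.
have [tI|tI] := boolP (0 <= t <= pi); last first.
  have t0 : \1_Ipi t = 0 :> R.
    rewrite indicE mem_setE in_itv/=.
    have [/andP[t1 t2]|//] := boolP (0 < t < pi).
    by rewrite (ltW t1) (ltW t2) in tI.
  by rewrite /Rintegral integral0_eq// => f _; rewrite /q t0 !mul0r.
(* The polar end points are harmless because sin vanishes there. *)
have qtE f : q r (t, f) = \1_I2pi f * (k (spherical (r, t, f)) * sin t).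
  rewrite /q/= indicE mem_setE in_itv/=.
  have [_|] := boolP (0 < t < pi); first by rewrite mul1r.
  move: tI; rewrite !le_eqVlt => /andP[/orP[/eqP <-|->]] /orP[/eqP ->|->]//;
  by rewrite ?sin0 ?sinpi !mulr0.
rewrite /Rintegral integral_itv_bndoo; last first.
  by apply/measurable_EFinP/measurable_funTS; exact: mks.
rewrite [in RHS]integral_mkcond; congr fine; apply: eq_integral => f _.
rewrite qtE patchE indicE.
by case: (f \in I2pi); rewrite ?mul1r ?mul0r.
Qed.

Hypothesis fi : (lebesgue3 R).-integrable setT
  (EFin \o (fun s : X3 => k s * w (norm3 s))).

Lemma Rintegral_spherical :
  mu.-integrable setT
    (EFin \o (fun r => \1_Ipos r * (angular_integral r * w r * r ^+ 2))) /\
  \int[lebesgue3 R]_s (k s * w (norm3 s)) =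
  \int[mu]_r (\1_Ipos r * (angular_integral r * w r * r ^+ 2)).
Proof.
have mT : measurable_fun setT (spherical : X3 -> X3).
  by rewrite /spherical; solve_measurable.
have mJ : measurable_fun setT (spherical_jacobian : X3 -> R).
  by rewrite /spherical_jacobian; solve_measurable.
have H := @integrable_transfer _ _ X3 X3 R (lebesgue3 R) (lebesgue3 R)
  spherical spherical_jacobian mT mJ (@spherical_jacobian_ge0 R)
  (@ge0_integral_spherical R) _ fi.
have E := @Rintegral_transfer _ _ X3 X3 R (lebesgue3 R) (lebesgue3 R)
  spherical spherical_jacobian (@spherical_jacobian_ge0 R)
  (@ge0_integral_spherical R) _ fi.
have [H1 H2] := Rintegral_lebesgue3 H.
have rE r : \int[mu]_t \int[mu]_f (spherical_jacobian (r, t, f) *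
    (k (spherical (r, t, f)) * w (norm3 (spherical (r, t, f))))) =
    \1_Ipos r * (angular_integral r * w r * r ^+ 2).
  rewrite -qE -(Rintegral_fubini1 (qi r)).
  transitivity (\int[mu]_t \int[mu]_f (\1_Ipos r * w r * r ^+ 2 * q r (t, f))).
    apply: eq_Rintegral => t _; apply: eq_Rintegral => f _.
    rewrite /spherical_jacobian /q/=.
    have [r0|r0] := leP 0 r; first by rewrite norm3_spherical//=; ring.
    by rewrite [\1_Ipos _]indicE mem_setE in_itv/= ltNge (ltW r0)/= !mul0r.
  have qi' : (lebesgue2 R).-integrable setT
      (EFin \o (fun p => \1_Ipos r * w r * r ^+ 2 * q r p)).
    exact: (integrableZl measurableT (\1_Ipos r * w r * r ^+ 2) (qi r)).
  rewrite -(Rintegral_fubini1 qi') (RintegralZl _ measurableT (qi r)).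
  by ring.
split.
  by apply: eq_integrable H1 => // r _ /=; rewrite -rE.
by rewrite E H2; apply: eq_Rintegral => r _; rewrite -rE.
Qed.

End radial_angular_split.

(** * The entries of the stiffness matrix *)

Section matrix_entry.
Context {R : realType}.
Local Notation mu := (@lebesgue_measure R).
Local Notation X3 := (measurableTypeR R * measurableTypeR R * measurableTypeR R)%type.
Local Notation Ipos := ([set` `]0, +oo[%R] : set R).

Lemma hat_out (a b h x : R) (N n : nat) : 0 < h -> b = a + N.+1%:R * h ->
  (0 < n <= N)%N -> ~~ (a < x < b) -> hat a h n x = 0.
Proof.
move=> h0 -> /andP[n0 nN] xab; rewrite hatE//; apply: tent_eq0.
have n1 : 1 <= n%:R :> R by rewrite ler1n.
have n2 : n%:R + 1 <= N.+1%:R :> R by rewrite -natr1 lerD2r ler_nat.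
move: xab; rewrite negb_and -!leNgt => /orP[xa|bx].
  have : (x - a) / h <= 0 by rewrite pmulr_lle0 ?invr_gt0// subr_le0.
  by move=> y0; rewrite ler0_norm; lra.
have : N.+1%:R <= (x - a) / h by rewrite ler_pdivlMr// lerBrDl.
by move=> y0; rewrite ger0_norm; lra.
Qed.

Lemma natr_sub_sign (n m : nat) :
  n%:R - m%:R = (-1) ^+ (n < m)%N * `|n - m|%N%:R :> R.
Proof.
case: ltnP => nm.
  by rewrite distnEr ?(ltnW nm)// natrB ?(ltnW nm)// mulN1r opprB.
by rewrite distnEl// natrB// mul1r.
Qed.

(** Telescope the difference of the two products one factor at a time; the other
    factors are bounded by 1. *)
Lemma hat3_lip (a : R * R * R) (h : R) (n1 n2 n3 : nat) (x s : R * R * R) :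
  0 < h -> (0 < n1)%N -> (0 < n2)%N -> (0 < n3)%N ->
  `|hat3 a h n1 n2 n3 (x + s) - hat3 a h n1 n2 n3 x| <= 3 / h * norm3 s.
Proof.
move=> h0 n10 n20 n30; have [s1 s2 s3] := coord_le_norm3 s.
have L (c y z w : R) n : (0 < n)%N -> `|z| <= w ->
    `|hat c h n (y + z) - hat c h n y| <= w / h.
  move=> n0 zw; apply: (le_trans (hat_lip _ _ _ h0 n0)).
  by rewrite [y + z]addrC addrK ler_pM2r ?invr_gt0.
have L1 := L a.1.1 x.1.1 _ _ _ n10 s1.
have L2 := L a.1.2 x.1.2 _ _ _ n20 s2.
have L3 := L a.2 x.2 _ _ _ n30 s3.
have B n c y : (0 < n)%N -> `|hat c h n y| <= 1.
  by move=> n0; rewrite ger0_norm ?hat_ge0 ?hat_le1.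
rewrite /hat3/=.
move: L1 L2 L3 (B _ a.1.1 (x.1.1 + s.1.1) n10) (B _ a.1.2 (x.1.2 + s.1.2) n20)
  (B _ a.1.2 x.1.2 n20) (B _ a.2 x.2 n30).
set f' := hat _ _ n1 (_ + _); set f := hat _ _ n1 _.
set g' := hat _ _ n2 (_ + _); set g := hat _ _ n2 _.
set e' := hat _ _ n3 (_ + _); set e := hat _ _ n3 _.
move=> L1 L2 L3 bf' bg' bg be.
rewrite (_ : f' * g' * e' - f * g * e =
  f' * g' * (e' - e) + f' * (g' - g) * e + (f' - f) * g * e); last by ring.
rewrite (_ : 3 / h * norm3 s = 1 * 1 * (norm3 s / h) + 1 * (norm3 s / h) * 1 +
  (norm3 s / h) * 1 * 1); last by ring.
apply: (le_trans (ler_normD _ _)); apply: lerD; last first.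
  by rewrite !normrM; do 2 (apply: ler_pM; rewrite ?mulr_ge0//).
apply: (le_trans (ler_normD _ _)); apply: lerD.
  by rewrite !normrM; do 2 (apply: ler_pM; rewrite ?mulr_ge0//).
by rewrite !normrM; do 2 (apply: ler_pM; rewrite ?mulr_ge0//).
Qed.

Lemma measurable_hat3 (a : R * R * R) (h : R) (n1 n2 n3 : nat) :
  0 < h -> (0 < n1)%N -> (0 < n2)%N -> (0 < n3)%N ->
  measurable_fun setT (hat3 a h n1 n2 n3 : X3 -> R).
Proof.
move=> h0 n10 n20 n30.
have m1 := measurable_hat a.1.1 h0 n10.
have m2 := measurable_hat a.1.2 h0 n20.
have m3 := measurable_hat a.2 h0 n30.
rewrite (_ : (hat3 a h n1 n2 n3 : X3 -> R) = fun x : X3 =>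
  hat a.1.1 h n1 x.1.1 * hat a.1.2 h n2 x.1.2 * hat a.2 h n3 x.2) //.
by solve_measurable.
Qed.

Lemma fhatE (h : R) (k1 k2 k3 : nat) (r t f : R) :
  fhat h k1 k2 k3 r t f =
  increment_kernel h (k1%:R, k2%:R, k3%:R) (spherical (r, t, f)).
Proof.
by rewrite /fhat /increment_kernel /overlap /spherical /= !mul0r !add0r !mulNr
  ![(_ + _ / h)%R]addrC ![(_ - _ / h)%R]addrC -!addrA
  ![(_ + 2)%R]addrC -?addrA; ring.
Qed.

Section one_entry.
Variables (a b : R * R * R) (h delta : R) (rho : R -> R) (N1 N2 N3 : nat).
Hypothesis h0 : 0 < h.
Hypotheses (b1E : b.1.1 = a.1.1 + N1.+1%:R * h)
  (b2E : b.1.2 = a.1.2 + N2.+1%:R * h) (b3E : b.2 = a.2 + N3.+1%:R * h).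
Hypothesis delta_gt0 : 0 < delta.
Hypothesis rho_nonincreasing :
  forall r s : R, 0 < r -> r <= s -> s < delta -> rho s <= rho r.
Hypothesis rho_normalized :
  \int[lebesgue3 R]_(s in ball3 delta) (rho (norm3 s) * norm3 s ^+ 2) = 3.
Variables n1 n2 n3 m1 m2 m3 : nat.
Hypotheses (n1N : (0 < n1 <= N1)%N) (n2N : (0 < n2 <= N2)%N)
  (n3N : (0 < n3 <= N3)%N) (m1N : (0 < m1 <= N1)%N) (m2N : (0 < m2 <= N2)%N)
  (m3N : (0 < m3 <= N3)%N).

Let u := hat3 a h n1 n2 n3.
Let v := hat3 a h m1 m2 m3.
Let d : R * R * R := (n1%:R - m1%:R, n2%:R - m2%:R, n3%:R - m3%:R).
Let k : R * R * R := (`|n1 - m1|%N%:R, `|n2 - m2|%N%:R, `|n3 - m3|%N%:R).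
Let sg := ((n1 < m1)%N, (n2 < m2)%N, (n3 < m3)%N).
Let w := cutoff delta rho.

Let kernel_integral :
  (lebesgue3 R).-integrable setT
    (EFin \o (fun s : X3 => increment_kernel h k s * w (norm3 s))) /\
  bilinear_form a b delta rho u v =
  h ^+ 3 / 2 * \int[lebesgue3 R]_s (increment_kernel h k s * w (norm3 s)).
Proof.
have n10 : (0 < n1)%N by case/andP: n1N.
have n20 : (0 < n2)%N by case/andP: n2N.
have n30 : (0 < n3)%N by case/andP: n3N.
have m10 : (0 < m1)%N by case/andP: m1N.
have m20 : (0 < m2)%N by case/andP: m2N.
have m30 : (0 < m3)%N by case/andP: m3N.
have L0 : 0 <= 3 / h by rewrite divr_ge0// ltW.
have uout x : ~ box3 a b x -> u x = 0.
  move=> xO; rewrite /u /hat3.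
  have [x1|x1] := boolP (a.1.1 < x.1.1 < b.1.1); last first.
    by rewrite (hat_out h0 b1E n1N x1) !mul0r.
  have [x2|x2] := boolP (a.1.2 < x.1.2 < b.1.2); last first.
    by rewrite (hat_out h0 b2E n2N x2) mulr0 mul0r.
  have [x3|x3] := boolP (a.2 < x.2 < b.2); last first.
    by rewrite (hat_out h0 b3E n3N x3) mulr0.
  by exfalso; apply: xO.
have Di s : (lebesgue3 R).-integrable setT
    (EFin \o (fun x : X3 => (u (x + s) - u x) * (v (x + s) - v x))).
  exact: integrable_increments.
have [] := bilinear_form_swap delta_gt0 rho_nonincreasing rho_normalized
  (measurable_hat3 a h0 n10 n20 n30) (measurable_hat3 a h0 m10 m20 m30) L0
  (fun x s => hat3_lip a x s h0 n10 n20 n30)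
  (fun x s => hat3_lip a x s h0 m10 m20 m30) uout Di.
have KE s : \int[lebesgue3 R]_x ((u (x + s) - u x) * (v (x + s) - v x)) =
    h ^+ 3 * increment_kernel h d s.
  exact: Rintegral_increments.
move=> I1 E1.
have I2 : (lebesgue3 R).-integrable setT
    (EFin \o (fun s : X3 => increment_kernel h d s * w (norm3 s))).
  have := integrableZl measurableT (h ^- 3) I1.
  apply: eq_integrable => // s _ /=; rewrite KE -EFinM; congr EFin.
  by rewrite mulrA mulKf// expf_neq0// gt_eqF.
(* Reflect s in the coordinates where the index difference is negative. *)
have dE : d = reflect3 sg k by rewrite /d /reflect3 /sg /k /= !natr_sub_sign.
have refl s : increment_kernel h d (reflect3 sg s) * w (norm3 (reflect3 sg s)) =
    increment_kernel h k s * w (norm3 s).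
  by rewrite dE increment_kernel_reflect norm3_reflect.
have mr : measurable_fun setT (reflect3 sg : X3 -> X3).
  rewrite (_ : (reflect3 sg : X3 -> X3) = fun s : X3 =>
    ((-1) ^+ sg.1.1 * (s.1.1 : R), (-1) ^+ sg.1.2 * (s.1.2 : R),
     (-1) ^+ sg.2 * (s.2 : R))) //.
  by solve_measurable.
have J := @integrable_transfer _ _ X3 X3 R (lebesgue3 R) (lebesgue3 R)
  (reflect3 sg) (cst 1) mr (@measurable_cst _ _ _ _ _ _) (fun=> ler01)
  (@ge0_integral_reflect3 R sg) _ I2.
have E2 := @Rintegral_transfer _ _ X3 X3 R (lebesgue3 R) (lebesgue3 R)
  (reflect3 sg) (cst 1) (fun=> ler01) (@ge0_integral_reflect3 R sg) _ I2.
split.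
  by apply: eq_integrable J => // s _ /=; rewrite mul1r refl.
rewrite E1 (_ : \int[lebesgue3 R]_s _ = \int[lebesgue3 R]_s
  (h ^+ 3 * (increment_kernel h d s * w (norm3 s)))); last first.
  by apply: eq_Rintegral => s _; rewrite KE mulrA.
rewrite (RintegralZl _ measurableT I2) E2 mulrA [_^-1 * _]mulrC; congr (_ * _).
by apply: eq_Rintegral => s _; rewrite mul1r refl.
Qed.

(** The entry is the kernel integral in spherical coordinates.  The cutoff profile
    and [rho] agree on ]0, delta[, and the end points of the radial interval do not
    contribute. *)
Lemma bilinear_form_hat3 :
  bilinear_form a b delta rho u v =
  toeplitz_entry h delta rho `|n1 - m1|%N `|n2 - m2|%N `|n3 - m3|%N.
Proof.
have [I ->] := kernel_integral.
have [I1 E1] := Rintegral_spherical (measurable_increment_kernel h k)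
  (increment_kernel_bounded h k) I.
rewrite /toeplitz_entry; congr (_ * _); rewrite E1.
have pE r : 0 < r < delta ->
    \1_Ipos r * (angular_integral (increment_kernel h k) r * w r * r ^+ 2) =
    angular_integral (increment_kernel h k) r * rho r * r ^+ 2.
  move=> rd; rewrite /w cutoff_in//; case/andP: rd => r0 _.
  by rewrite indicE mem_setE in_itv/= r0 mul1r.
transitivity (\int[mu]_(r in `]0, delta[)
    (angular_integral (increment_kernel h k) r * rho r * r ^+ 2)).
  rewrite [RHS]Rintegral_mkcond; apply: eq_Rintegral => r _.
  rewrite patchE mem_setE in_itv/=; case: ifPn => rd; first exact: pE.
  rewrite indicE mem_setE in_itv/= andbT; case: ltP => r0; last by rewrite mul0r.
  move: rd; rewrite r0/= -leNgt => dr.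
  by rewrite /w cutoff_out// mulr0 !mul0r mulr0.
transitivity (\int[mu]_(r in `[0, delta])
    (angular_integral (increment_kernel h k) r * rho r * r ^+ 2)).
  have I2 : mu.-integrable `]0, delta[ (EFin \o (fun r =>
      \1_Ipos r * (angular_integral (increment_kernel h k) r * w r * r ^+ 2))).
    by apply: (integrableS measurableT) I1 => //; exact: measurable_itv.
  have I3 : mu.-integrable `]0, delta[ (EFin \o (fun r =>
      angular_integral (increment_kernel h k) r * rho r * r ^+ 2)).
    apply: eq_integrable I2 => [|r]; first exact: measurable_itv.
    by rewrite mem_setE in_itv/= => rd; congr EFin; exact: pE.
  rewrite /Rintegral [in RHS]integral_itv_bndoo//.
  exact: (measurable_int mu I3).
have angularE r : angular_integral (increment_kernel h k) r =
    \int[mu]_(t in `[0, pi]) \int[mu]_(f in `[0, (2 * pi)%R])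
      (fhat h `|n1 - m1|%N `|n2 - m2|%N `|n3 - m3|%N r t f * sin t).
  by apply: eq_Rintegral => t _; apply: eq_Rintegral => f _; rewrite fhatE.
by apply: eq_Rintegral => r _; rewrite -angularE.
Qed.

End one_entry.
End matrix_entry.

(** * The three-level Toeplitz structure *)

(** The index [p * n + i] is the rank of position [i] in block [p]. *)
Lemma block_toeplitz_mxE (R : realType) (m n : nat) (T : nat -> 'M[R]_n)
    (p q : 'I_m) (i j : 'I_n) (l l' : 'I_(m * n)) :
  l = (p * n + i)%N :> nat -> l' = (q * n + j)%N :> nat ->
  block_toeplitz_mx m T l l' = T `|p - q|%N i j.
Proof.
move=> lE l'E; rewrite /block_toeplitz_mx castmxE.
have rankE (o : 'I_m) (k : 'I_n) (t : 'I_(m * n)) : t = (o * n + k)%N :> nat ->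
    cast_ord (esym (block_dim m n)) t = @tagnat.Rank m (fun=> n) o k.
  move=> tE; apply/val_inj/esym; apply: (etrans (@tagnat.RankEsum m (fun=> n) o k)).
  rewrite /= tE; congr (_ + _)%N.
  by rewrite -(big_ord_widen m (fun=> n)) ?(ltnW (ltn_ord o))// sum_nat_const card_ord.
rewrite (rankE p i)// (rankE q j)//.
have := mxblockK (fun p q : 'I_m => T `|p - q|%N) p q.
by move/matrixP/(_ i j); rewrite mxE.
Qed.

Lemma ord_block (m n : nat) (l : 'I_(m * n)) :
  exists (p : 'I_m) (i : 'I_n), l = (p * n + i)%N :> nat.
Proof.
have n0 : (0 < n)%N.
  by have := leq_ltn_trans (leq0n l) (ltn_ord l); rewrite muln_gt0 => /andP[].
have pm : (l %/ n < m)%N by rewrite ltn_divLR.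
exists (Ordinal pm), (Ordinal (ltn_pmod l n0)) => /=.
exact: divn_eq.
Qed.

Theorem corollary2 (R : realType) (a1 a2 a3 b1 b2 b3 h delta : R)
    (N1 N2 N3 : nat) (rho : R -> R)
    (ab1 : a1 < b1) (ab2 : a2 < b2) (ab3 : a3 < b3)
    (N1_ge1 : (1 <= N1)%N) (N2_ge1 : (1 <= N2)%N) (N3_ge1 : (1 <= N3)%N)
    (h1 : h = (b1 - a1) / N1.+1%:R)
    (h2 : h = (b2 - a2) / N2.+1%:R)
    (h3 : h = (b3 - a3) / N3.+1%:R)
    (delta_gt0 : 0 < delta)
    (rho_nonincreasing :
       forall r s : R, 0 < r -> r <= s -> s < delta -> rho s <= rho r)
    (rho_normalized :
       \int[lebesgue3 R]_(s in ball3 delta) (rho (norm3 s) * norm3 s ^+ 2)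
       = 3) :
  stiffness_matrix (a1, a2, a3) (b1, b2, b3) h delta rho N1 N2 N3 =
  block_toeplitz_mx N3 (fun k3 =>
    block_toeplitz_mx N2 (fun k2 =>
      toeplitz_mx N1 (fun k1 => toeplitz_entry h delta rho k1 k2 k3))).
Proof.
have h0 : 0 < h by rewrite h1 divr_gt0// subr_gt0.
have bE (a b : R) (N : nat) : h = (b - a) / N.+1%:R -> b = a + N.+1%:R * h.
  by move=> ->; rewrite mulrC divfK ?pnatr_eq0// addrC subrK.
apply/matrixP => l l'.
have [p3 [e lE]] := ord_block l; have [p2 [p1 eE]] := ord_block e.
have [q3 [e' l'E]] := ord_block l'; have [q2 [q1 e'E]] := ord_block e'.
rewrite (block_toeplitz_mxE _ lE l'E) (block_toeplitz_mxE _ eE e'E) [RHS]mxE.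
have distS (x y : nat) : `|x.+1 - y.+1|%N = `|x - y|%N.
  by rewrite -[x.+1]addn1 -[y.+1]addn1 distnDr.
rewrite (@stiffness_matrixE R (a1, a2, a3) (b1, b2, b3) h delta rho N1 N2 N3
  p1.+1 p2.+1 p3.+1 q1.+1 q2.+1 q3.+1 l l') ?ltn_ord//; last 2 first.
- by rewrite /= lE eE addnS -mulnA [(N1 * N2)%N]mulnC addnA.
- by rewrite /= l'E e'E addnS -mulnA [(N1 * N2)%N]mulnC addnA.
rewrite -(distS p1 q1) -(distS p2 q2) -(distS p3 q3).
by apply: (@bilinear_form_hat3 R (a1, a2, a3) (b1, b2, b3) h delta rho N1 N2 N3) => //=;
  rewrite ?ltn_ord//; exact: bE.
Qed.
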